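(* Let $R$ be a Noetherian commutative ring with non-zero identity and $I$ an ideal of $R$. Let $M$ be a finitely generated $R$-module. (i) If $N$ is an Artinian $R$-module, then $R^iD_I(M,N)$ is Artinian for all $i\geq 0$. (ii) If $N$ is a finitely generated $R$-module such that $p=\mathrm{pd}(M)$ and $d=\dim(N)$ are finite, then $R^{p+d}D_I(M,N)$ is an Artinian $R$-module.
   Context: For $R$-modules $M,N$, the generalized ideal transform is $D_I(M,N)=\varinjlim_n \mathrm{Hom}_R(I^nM,N)$, the transition maps being restriction along $I^{j}M\subseteq I^{i}M$ for $i\le j$. $R^iD_I(M,-)$ denotes the $i$-th right derived functor of the functor $D_I(M,-)$ (so $R^0D_I(M,-)=D_I(M,-)$); it is isomorphic to $\varinjlim_n \mathrm{Ext}^i_R(I^nM,-)$. $\mathrm{pd}(M)$ is the projective dimension of $M$ and $\dim(N)$ the Krull dimension of $N$. *)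

(* Defs.v *)
From HB Require Import structures.
From mathcomp Require Import all_boot all_algebra.
From mathcomp Require Import boolp.

Set Implicit Arguments.
Unset Strict Implicit.
Unset Printing Implicit Defensive.

Import GRing.Theory.
Local Open Scope ring_scope.
Local Open Scope quotient_scope.

(* The logic is classical: Prop-valued conditions are turned into boolean     *)
(* predicates by `[< _ >].                                                    *)

(* The library's submodClosed is stated over semimodules and does not inherit *)
(* ZmodClosed, hence this packaging. Ideals of R are the terms of             *)
(* submodule R^o, so that, unlike with the library's idealr, the unit ideal   *)
(* is allowed.                                                                *)
Record submodule (R : pzRingType) (V : lmodType R) := Submodule {
  submodule_pred :> {pred V};
  submodule_closed : submod_closed submodule_pred
}.

HB.instance Definition _ (R : pzRingType) (V : lmodType R) (S : submodule V) :=
  GRing.isSubmodClosed.Build R V (submodule_pred S) (submodule_closed S).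

Section SubQuotient.
Variables (R : pzRingType) (V : lmodType R).

Section Sub.
Variable S : submodule V.

Definition submod : Type := {x : V | x \in S}.

HB.instance Definition _ := SubType.copy submod {x : V | x \in S}.
HB.instance Definition _ := [Choice of submod by <:].
HB.instance Definition _ := [SubChoice_isSubLmodule of submod by <:].

(* The additive group is the library's Quotient.quot. *)
Definition quotmod : Type := Quotient.quot (submodule_pred S).

HB.instance Definition _ := GRing.Zmodule.on quotmod.

Definition quotmod_proj (x : V) : quotmod :=
  \pi_(Quotient.quot (submodule_pred S)) x.

Lemma quotmod_projP (u : quotmod) : exists x, u = quotmod_proj x.
Proof. by exists (repr u); rewrite /quotmod_proj reprK. Qed.

Lemma quotmod_proj_eq x y : quotmod_proj x = quotmod_proj y <-> x - y \in S.
Proof.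
split=> [e|e]; first by rewrite Quotient.idealrBE; apply/eqP.
by apply/eqP; rewrite /quotmod_proj -Quotient.idealrBE.
Qed.

Lemma quotmod_projD x y :
  quotmod_proj (x + y) = quotmod_proj x + quotmod_proj y.
Proof. exact: (raddfD (\pi_(Quotient.quot (submodule_pred S)))). Qed.

Definition quotmod_scale (a : R) (u : quotmod) : quotmod :=
  quotmod_proj (a *: repr (u : Quotient.quot (submodule_pred S))).

Lemma quotmod_scaleE a x :
  quotmod_scale a (quotmod_proj x) = quotmod_proj (a *: x).
Proof.
apply/quotmod_proj_eq; rewrite -scalerBr rpredZ //.
by apply/quotmod_proj_eq; rewrite /quotmod_proj reprK.
Qed.

Fact quotmod_scaleA a b u :
  quotmod_scale a (quotmod_scale b u) = quotmod_scale (a * b) u.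
Proof. by have [x ->] := quotmod_projP u; rewrite !quotmod_scaleE scalerA. Qed.

Fact quotmod_scale1 : left_id 1 quotmod_scale.
Proof.
by move=> u; have [x ->] := quotmod_projP u; rewrite quotmod_scaleE scale1r.
Qed.

Fact quotmod_scaleDr : right_distributive quotmod_scale +%R.
Proof.
move=> a u v; have [x ->] := quotmod_projP u; have [y ->] := quotmod_projP v.
by rewrite -quotmod_projD !quotmod_scaleE scalerDr quotmod_projD.
Qed.

Fact quotmod_scaleDl u : {morph quotmod_scale^~ u : a b / a + b}.
Proof.
move=> a b; have [x ->] := quotmod_projP u.
by rewrite !quotmod_scaleE scalerDl quotmod_projD.
Qed.

HB.instance Definition _ := GRing.Zmodule_isLmodule.Build R quotmod
  quotmod_scaleA quotmod_scale1 quotmod_scaleDr quotmod_scaleDl.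

End Sub.

Definition fullsub_pred : {pred V} := predT.

Fact fullsub_closed : submod_closed fullsub_pred. Proof. by []. Qed.

Definition fullsub : submodule V := Submodule fullsub_closed.

Definition zerosub_pred : {pred V} := pred1 0.

Fact zerosub_closed : submod_closed zerosub_pred.
Proof.
split=> [|a x y]; rewrite ?inE // => /eqP-> /eqP->.
by rewrite scaler0 addr0.
Qed.

Definition zerosub : submodule V := Submodule zerosub_closed.

Section Incl.
Variables (S T : submodule V) (sST : {subset S <= T}).

Definition incl (x : submod S) : submod T := Sub (val x) (sST (valP x)).

Fact incl_linear : linear incl.
Proof. by move=> a x y; apply: val_inj; rewrite !(linearP, SubK). Qed.

HB.instance Definition _ := GRing.isLinear.Build R (submod S) (submod T) _ incl
  incl_linear.
End Incl.

(* The submodule B :&: S, seen inside S. *)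
Definition subin_pred (S B : submodule V) : {pred submod S} :=
  [pred x | val x \in B].

Fact subin_closed S B : submod_closed (@subin_pred S B).
Proof.
split=> [|a x y]; rewrite !inE ?raddf0 ?rpred0 // => xB yB.
by rewrite linearP rpredD ?rpredZ.
Qed.

Definition subin (S B : submodule V) : submodule (submod S) :=
  Submodule (@subin_closed S B).

End SubQuotient.

Section KerIm.
Variables (R : pzRingType) (U V : lmodType R) (f : {linear U -> V}).

Definition kersub_pred : {pred U} := [pred x | f x == 0].

Fact kersub_closed : submod_closed kersub_pred.
Proof.
split=> [|a x y]; rewrite !inE ?raddf0 // => /eqP fx /eqP fy.
by rewrite linearP fx fy scaler0 addr0.
Qed.

Definition kersub : submodule U := Submodule kersub_closed.

Definition imsub_pred : {pred V} := [pred y | `[< exists x, f x = y >]].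

Fact imsub_closed : submod_closed imsub_pred.
Proof.
split=> [|a y z]; rewrite !inE.
  by apply/asboolP; exists 0; rewrite raddf0.
move=> /asboolP[x <-] /asboolP[x' <-].
by apply/asboolP; exists (a *: x + x'); rewrite linearP.
Qed.

Definition imsub : submodule V := Submodule imsub_closed.

End KerIm.

Section ChainConditions.
Variables (R : pzRingType) (V : lmodType R).

Definition artinian : Prop :=
  forall S : nat -> submodule V,
    (forall n, {subset S n.+1 <= S n}) ->
    exists n, forall m, (n <= m)%N -> S m =i S n.

Definition noetherian : Prop :=
  forall S : nat -> submodule V,
    (forall n, {subset S n <= S n.+1}) ->
    exists n, forall m, (n <= m)%N -> S m =i S n.

Definition fin_gen : Prop :=
  exists n (g : 'I_n -> V),
    forall x, exists c : 'I_n -> R, x = \sum_(k < n) c k *: g k.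

End ChainConditions.

Definition noetherian_ring (R : pzRingType) : Prop :=
  noetherian (R^o : lmodType R).

Section IdealPowers.
Variable R : comNzRingType.

Section Mul.
Variables (V : lmodType R) (I : submodule R^o) (S : submodule V).

Definition idealmul_pred : {pred V} := [pred v | `[< exists n,
  exists a : 'I_n -> R, exists x : 'I_n -> V,
  (forall k, a k \in I /\ x k \in S) /\ v = \sum_(k < n) a k *: x k >]].

Fact idealmul_closed : submod_closed idealmul_pred.
Proof.
split=> [|c u v]; rewrite !inE.
  apply/asboolP; exists 0%N, (fun=> 0), (fun=> 0).
  by split=> [[]//|]; rewrite big_ord0.
move=> /asboolP[n [a [x [ax ->]]]] /asboolP[m [b [y [bY ->]]]].
apply/asboolP; exists (n + m)%N.
exists (fun k => match split k with inl i => c * a i | inr j => b j end).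
exists (fun k => match split k with inl i => x i | inr j => y j end).
split=> [k|].
  case: (split k) => i; last exact: bY.
  have [aI xS] := ax i; split=> //.
  exact: (@rpredZ _ _ (submodule_pred I : submodClosed R^o) c _ aI).
rewrite big_split_ord scaler_sumr; congr (_ + _); apply: eq_bigr => i _.
  by rewrite (unsplitK (inl _ i)) scalerA.
by rewrite (unsplitK (inr _ i)).
Qed.

Definition idealmul : submodule V := Submodule idealmul_closed.

Lemma idealmul_sub : {subset idealmul <= S}.
Proof.
move=> v; rewrite inE => /asboolP[n [a [x [ax ->]]]].
by apply: rpred_sum => k _; rewrite rpredZ // (ax k).2.
Qed.

End Mul.

Fixpoint idealpow (I : submodule R^o) (n : nat) : submodule R^o :=
  if n is k.+1 then idealmul I (idealpow I k) else fullsub R^o.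

Definition idealpow_mod (I : submodule R^o) (M : lmodType R) (n : nat) :
  submodule M := idealmul (idealpow I n) (fullsub M).

Lemma idealpow_sub I i j : (i <= j)%N ->
  {subset idealpow I j <= idealpow I i}.
Proof.
move=> /subnK <-; elim: (j - i)%N => [|k IHk] x //.
by rewrite addSn => /idealmul_sub /IHk.
Qed.

Lemma idealpow_mod_sub I M i j : (i <= j)%N ->
  {subset idealpow_mod I M j <= idealpow_mod I M i}.
Proof.
move=> ij v; rewrite !inE => /asboolP[n [a [x [ax ->]]]].
apply/asboolP; exists n, a, x; split=> // k.
by have [aI xS] := ax k; split=> //; apply: idealpow_sub aI.
Qed.

End IdealPowers.

Section Hom.
Variables (R : comNzRingType) (U V : lmodType R).

Definition hom : Type := {linear U -> V}.

Definition hom_fun (f : hom) : {linear U -> V} := f.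
Coercion hom_fun : hom >-> GRing.Linear.type.

Lemma hom_ext (f g : hom) : f =1 g -> f = g.
Proof.
case: f g => [f cf] [g cg] /= fg.
have {}fg : f = g by apply: funext.
case: g / fg cg => cg; congr (GRing.Linear.Pack _).
by case: cf cg => [[x] [y]] [[z] [t]]; congr (GRing.Linear.Class _ _);
  congr (_ _); apply: Prop_irrelevance.
Qed.

HB.instance Definition _ := gen_eqMixin hom.
HB.instance Definition _ := gen_choiceMixin hom.

Definition hom_zero : hom := (\0 : {linear U -> V}).
Definition hom_opp (f : hom) : hom := (\- f : {linear U -> V}).
Definition hom_add (f g : hom) : hom := (f \+ g : {linear U -> V}).
Definition hom_scale (a : R) (f : hom) : hom := (a \*: f : {linear U -> V}).

Fact hom_addA : associative hom_add.
Proof. by move=> f g h; apply: hom_ext => x /=; rewrite addrA. Qed.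
Fact hom_addC : commutative hom_add.
Proof. by move=> f g; apply: hom_ext => x /=; rewrite addrC. Qed.
Fact hom_add0 : left_id hom_zero hom_add.
Proof. by move=> f; apply: hom_ext => x /=; rewrite add0r. Qed.
Fact hom_addN : left_inverse hom_zero hom_opp hom_add.
Proof. by move=> f; apply: hom_ext => x /=; rewrite addNr. Qed.

HB.instance Definition _ := GRing.isZmodule.Build hom
  hom_addA hom_addC hom_add0 hom_addN.

Fact hom_scaleA a b f : hom_scale a (hom_scale b f) = hom_scale (a * b) f.
Proof. by apply: hom_ext => x /=; rewrite scalerA. Qed.
Fact hom_scale1 : left_id 1 hom_scale.
Proof. by move=> f; apply: hom_ext => x /=; rewrite scale1r. Qed.
Fact hom_scaleDr : right_distributive hom_scale +%R.
Proof. by move=> a f g; apply: hom_ext => x /=; rewrite scalerDr. Qed.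
Fact hom_scaleDl f : {morph hom_scale^~ f : a b / a + b}.
Proof. by move=> a b; apply: hom_ext => x /=; rewrite scalerDl. Qed.

HB.instance Definition _ := GRing.Zmodule_isLmodule.Build R hom
  hom_scaleA hom_scale1 hom_scaleDr hom_scaleDl.

End Hom.

Section HomMaps.
Variable R : comNzRingType.

Definition precomp (U U' V : lmodType R) (g : {linear U' -> U})
  (f : hom U V) : hom U' V := (f \o g : {linear U' -> V}).

Fact precomp_linear U U' V g : linear (@precomp U U' V g).
Proof. by move=> a f f'; apply: hom_ext. Qed.

HB.instance Definition _ U U' V g :=
  GRing.isLinear.Build R (hom U V) (hom U' V) _ (@precomp U U' V g)
    (@precomp_linear U U' V g).

Definition postcomp (U V V' : lmodType R) (g : {linear V -> V'})
  (f : hom U V) : hom U V' := (g \o f : {linear U -> V'}).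

Fact postcomp_linear U V V' g : linear (@postcomp U V V' g).
Proof. by move=> a f f'; apply: hom_ext => x /=; rewrite linearP. Qed.

HB.instance Definition _ U V V' g :=
  GRing.isLinear.Build R (hom U V) (hom U V') _ (@postcomp U V V' g)
    (@postcomp_linear U V V' g).

End HomMaps.

Record dirsys (R : pzRingType) := DirSys {
  ds_obj :> nat -> lmodType R;
  ds_map : forall i j, (i <= j)%N -> {linear ds_obj i -> ds_obj j};
  ds_map_id : forall i (h : (i <= i)%N) x, ds_map h x = x;
  ds_map_comp : forall i j k (hij : (i <= j)%N) (hjk : (j <= k)%N)
    (hik : (i <= k)%N) x, ds_map hjk (ds_map hij x) = ds_map hik x
}.

Section Colim.
Variables (R : pzRingType) (A : dirsys R).

Definition germ_eq : rel {i : nat & A i} := fun u v =>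
  `[< exists k, exists hu : (tag u <= k)%N, exists hv : (tag v <= k)%N,
        ds_map A hu (tagged u) = ds_map A hv (tagged v) >].

Fact germ_eq_equiv : equiv_class_of germ_eq.
Proof.
split=> [u|u v|v u w].
- by apply/asboolP; exists (tag u), (leqnn _), (leqnn _).
- by apply/asboolP/asboolP => -[k [hu [hv e]]]; exists k, hv, hu.
move=> /asboolP[k [hu [hv e]]] /asboolP[l [hv' [hw e']]].
have kkl : (k <= maxn k l)%N := leq_maxl k l.
have lkl : (l <= maxn k l)%N := leq_maxr k l.
apply/asboolP; exists (maxn k l), (leq_trans hu kkl), (leq_trans hw lkl).
rewrite -(ds_map_comp hu kkl) e (ds_map_comp hv kkl (leq_trans hv kkl)).
by rewrite -(ds_map_comp hw lkl) -e' (ds_map_comp hv' lkl (leq_trans hv kkl)).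
Qed.

Canonical germ_eq_equivRel := EquivRelPack germ_eq_equiv.
Canonical germ_eq_encModRel := defaultEncModRel germ_eq.

Definition colim : Type := {eq_quot germ_eq}.

HB.instance Definition _ : EqQuotient _ germ_eq colim := EqQuotient.on colim.
HB.instance Definition _ := Choice.on colim.

Definition colim_in i (x : A i) : colim :=
  \pi_colim (Tagged (fun i => A i : Type) x).

Lemma colim_in_eq i j (x : A i) (y : A j) :
  colim_in x = colim_in y <->
  exists k, exists hi : (i <= k)%N, exists hj : (j <= k)%N,
    ds_map A hi x = ds_map A hj y.
Proof.
split=> [/eqP|h]; first by rewrite eqmodE => /asboolP.
by apply/eqP; rewrite eqmodE; apply/asboolP.
Qed.

Lemma colim_in_map i j (h : (i <= j)%N) (x : A i) :
  colim_in (ds_map A h x) = colim_in x.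
Proof.
by apply/colim_in_eq; exists j, (leqnn j), h; rewrite (ds_map_comp _ _ h).
Qed.

Lemma colimP (u : colim) : exists i (x : A i), u = colim_in x.
Proof.
exists (tag (repr u)), (tagged (repr u)); rewrite -[LHS]reprK /colim_in.
by case: (repr u).
Qed.

Lemma colimP2 (u v : colim) :
  exists i (x y : A i), u = colim_in x /\ v = colim_in y.
Proof.
have [i [x ->]] := colimP u; have [j [y ->]] := colimP v.
exists (maxn i j), (ds_map A (leq_maxl i j) x), (ds_map A (leq_maxr i j) y).
by rewrite !colim_in_map.
Qed.

Lemma colimP3 (u v w : colim) : exists i (x y z : A i),
  [/\ u = colim_in x, v = colim_in y & w = colim_in z].
Proof.
have [i [x [y [-> ->]]]] := colimP2 u v; have [j [z ->]] := colimP w.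
exists (maxn i j), (ds_map A (leq_maxl i j) x), (ds_map A (leq_maxl i j) y),
  (ds_map A (leq_maxr i j) z).
by rewrite !colim_in_map.
Qed.

Definition colim_zero : colim := colim_in (0 : A 0%N).
Definition colim_opp (u : colim) : colim := colim_in (- tagged (repr u)).
Definition colim_add (u v : colim) : colim :=
  colim_in (ds_map A (leq_maxl _ (tag (repr v))) (tagged (repr u)) +
            ds_map A (leq_maxr (tag (repr u)) _) (tagged (repr v))).
Definition colim_scale (a : R) (u : colim) : colim :=
  colim_in (a *: tagged (repr u)).

Lemma colim_repr (u : colim) : colim_in (tagged (repr u)) = u.
Proof. by rewrite -[RHS]reprK /colim_in; case: (repr u). Qed.

Lemma colim_zeroE i : colim_in (0 : A i) = colim_zero.
Proof. by rewrite /colim_zero -(colim_in_map (leq0n i)) raddf0. Qed.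

Lemma colim_oppE i (x : A i) : colim_opp (colim_in x) = colim_in (- x).
Proof.
have /colim_in_eq[k [h [h' e]]] := colim_repr (colim_in x).
by apply/colim_in_eq; exists k, h, h'; rewrite !linearN /= e.
Qed.

Lemma colim_scaleE a i (x : A i) :
  colim_scale a (colim_in x) = colim_in (a *: x).
Proof.
have /colim_in_eq[k [h [h' e]]] := colim_repr (colim_in x).
by apply/colim_in_eq; exists k, h, h'; rewrite !linearZ /= e.
Qed.

Lemma colim_in_add i j k (x : A i) (y : A j) (x' y' : A k)
    (hi : (i <= maxn i j)%N) (hj : (j <= maxn i j)%N) :
  colim_in x = colim_in x' -> colim_in y = colim_in y' ->
  colim_in (ds_map A hi x + ds_map A hj y) = colim_in (x' + y').
Proof.
move=> /colim_in_eq[l [il [kl e]]] /colim_in_eq[m [jm [km f]]].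
pose n := maxn (maxn i j) (maxn l m).
have hn : (maxn i j <= n)%N := leq_maxl _ _.
have ln : (l <= n)%N by rewrite !leq_max leqnn orbT.
have mn : (m <= n)%N by rewrite !leq_max leqnn !orbT.
have kn := leq_trans kl ln.
apply/colim_in_eq; exists n, hn, kn; rewrite !linearD /=.
rewrite !(ds_map_comp hi hn (leq_trans hi hn)).
rewrite !(ds_map_comp hj hn (leq_trans hj hn)).
rewrite -(ds_map_comp il ln (leq_trans hi hn)) e (ds_map_comp kl ln kn).
by rewrite -(ds_map_comp jm mn (leq_trans hj hn)) f (ds_map_comp km mn kn).
Qed.

Lemma colim_addE i (x y : A i) :
  colim_add (colim_in x) (colim_in y) = colim_in (x + y).
Proof. by apply: colim_in_add; rewrite colim_repr. Qed.

Fact colim_addA : associative colim_add.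
Proof.
move=> u v w; have [i [x [y [z [-> -> ->]]]]] := colimP3 u v w.
by rewrite !colim_addE addrA.
Qed.
Fact colim_addC : commutative colim_add.
Proof.
move=> u v; have [i [x [y [-> ->]]]] := colimP2 u v.
by rewrite !colim_addE addrC.
Qed.
Fact colim_add0 : left_id colim_zero colim_add.
Proof.
move=> u; have [i [x ->]] := colimP u.
by rewrite -(colim_zeroE i) colim_addE add0r.
Qed.
Fact colim_addN : left_inverse colim_zero colim_opp colim_add.
Proof.
move=> u; have [i [x ->]] := colimP u.
by rewrite colim_oppE colim_addE addNr colim_zeroE.
Qed.

HB.instance Definition _ := GRing.isZmodule.Build colim
  colim_addA colim_addC colim_add0 colim_addN.

Fact colim_scaleA a b u :
  colim_scale a (colim_scale b u) = colim_scale (a * b) u.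
Proof.
by have [i [x ->]] := colimP u; rewrite !colim_scaleE scalerA.
Qed.
Fact colim_scale1 : left_id 1 colim_scale.
Proof.
by move=> u; have [i [x ->]] := colimP u; rewrite colim_scaleE scale1r.
Qed.
Fact colim_scaleDr : right_distributive colim_scale +%R.
Proof.
move=> a u v; have [i [x [y [-> ->]]]] := colimP2 u v.
by rewrite [_ + _]colim_addE !colim_scaleE scalerDr -colim_addE.
Qed.
Fact colim_scaleDl u : {morph colim_scale^~ u : a b / a + b}.
Proof.
move=> a b; have [i [x ->]] := colimP u.
by rewrite !colim_scaleE scalerDl -colim_addE.
Qed.

HB.instance Definition _ := GRing.Zmodule_isLmodule.Build R colim
  colim_scaleA colim_scale1 colim_scaleDr colim_scaleDl.

Fact colim_in_linear i : linear (@colim_in i).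
Proof. by move=> a x y; rewrite -colim_addE -colim_scaleE. Qed.

HB.instance Definition _ i := GRing.isLinear.Build R (A i) colim _
  (@colim_in i) (@colim_in_linear i).

End Colim.

Section ColimMap.
Variables (R : pzRingType) (A B : dirsys R).
Variable f : forall i, {linear A i -> B i}.
Hypothesis f_nat : forall i j (h : (i <= j)%N) x,
  f j (ds_map A h x) = ds_map B h (f i x).

Definition colim_map_fun (u : colim A) : colim B :=
  colim_in (f (tag (repr u)) (tagged (repr u))).

Lemma colim_map_funE i (x : A i) :
  colim_map_fun (colim_in x) = colim_in (f i x).
Proof using f_nat.
have /colim_in_eq[k [h [h' e]]] := colim_repr (colim_in x).
by apply/colim_in_eq; exists k, h, h'; rewrite -!f_nat e.
Qed.

Fact colim_map_linear : linear colim_map_fun.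
Proof using f_nat.
move=> a u v; have [i [x [y [-> ->]]]] := colimP2 u v.
by rewrite -linearP !colim_map_funE !linearP.
Qed.

Definition colim_map : {linear colim A -> colim B} :=
  HB.pack colim_map_fun
    (GRing.isLinear.Build R (colim A) (colim B) _ colim_map_fun
       colim_map_linear).

Lemma colim_mapE i (x : A i) : colim_map (colim_in x) = colim_in (f i x).
Proof. exact: colim_map_funE. Qed.

End ColimMap.

Record functor (R : pzRingType) := Functor {
  fobj :> lmodType R -> lmodType R;
  fmap : forall U V : lmodType R, {linear U -> V} -> {linear fobj U -> fobj V};
  fmap_id : forall (U : lmodType R) (f : {linear U -> U}),
    f =1 id -> fmap f =1 id;
  fmap_comp : forall (U V W : lmodType R) (f : {linear U -> V})
    (g : {linear V -> W}) (h : {linear U -> W}),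
    h =1 g \o f -> fmap h =1 fmap g \o fmap f;
  fmap_add : forall (U V : lmodType R) (f g h : {linear U -> V}),
    h =1 f \+ g -> fmap h =1 fmap f \+ fmap g
}.

Section IdealTransform.
Variables (R : comNzRingType) (I : submodule R^o) (M : lmodType R).

Definition transform_map (N : lmodType R) i j (h : (i <= j)%N) :
  {linear hom (submod (idealpow_mod I M i)) N ->
          hom (submod (idealpow_mod I M j)) N} :=
  precomp (incl (@idealpow_mod_sub R I M i j h)).

Fact transform_map_id N i (h : (i <= i)%N) f : transform_map N h f = f.
Proof.
by apply: hom_ext => x /=; congr (hom_fun f _); apply: val_inj; rewrite SubK.
Qed.

Fact transform_map_comp N i j k (hij : (i <= j)%N) (hjk : (j <= k)%N)
    (hik : (i <= k)%N) f :
  transform_map N hjk (transform_map N hij f) = transform_map N hik f.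
Proof.
by apply: hom_ext => x /=; congr (hom_fun f _); apply: val_inj; rewrite !SubK.
Qed.

Definition transform_sys (N : lmodType R) : dirsys R :=
  DirSys (transform_map_id (N := N)) (transform_map_comp (N := N)).

Definition ideal_transform_obj (N : lmodType R) : lmodType R :=
  colim (transform_sys N).

Definition transform_post (N N' : lmodType R) (g : {linear N -> N'}) i :
  {linear transform_sys N i -> transform_sys N' i} := postcomp g.

Fact transform_nat (N N' : lmodType R) (g : {linear N -> N'}) i j
    (h : (i <= j)%N) (f : transform_sys N i) :
  transform_post g j (ds_map (transform_sys N) h f) =
  ds_map (transform_sys N') h (transform_post g i f).
Proof. exact: hom_ext. Qed.

Definition ideal_transform_map (N N' : lmodType R) (g : {linear N -> N'}) :
  {linear ideal_transform_obj N -> ideal_transform_obj N'} :=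
  colim_map (@transform_nat N N' g).

Lemma ideal_transform_mapE (N N' : lmodType R) (g : {linear N -> N'}) i
    (f : transform_sys N i) :
  ideal_transform_map g (colim_in f) = colim_in (transform_post g i f).
Proof. exact: colim_mapE. Qed.

Fact ideal_transform_id (N : lmodType R) (g : {linear N -> N}) :
  g =1 id -> ideal_transform_map g =1 id.
Proof.
move=> g1 u; have [i [x ->]] := colimP u; rewrite ideal_transform_mapE.
by congr (colim_in _); apply: hom_ext => y /=; rewrite g1.
Qed.

Fact ideal_transform_comp (N N' N'' : lmodType R) (f : {linear N -> N'})
    (g : {linear N' -> N''}) (h : {linear N -> N''}) :
  h =1 g \o f ->
  ideal_transform_map h =1 ideal_transform_map g \o ideal_transform_map f.
Proof.
move=> hE u; have [i [x ->]] := colimP u.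
rewrite -[RHS]/(ideal_transform_map g (ideal_transform_map f (colim_in x))).
rewrite !ideal_transform_mapE.
by congr (colim_in _); apply: hom_ext => y /=; rewrite hE.
Qed.

Fact ideal_transform_add (N N' : lmodType R) (f g h : {linear N -> N'}) :
  h =1 f \+ g ->
  ideal_transform_map h =1 ideal_transform_map f \+ ideal_transform_map g.
Proof.
move=> hE u; have [i [x ->]] := colimP u.
rewrite -[RHS]/(ideal_transform_map f (colim_in x) +
  ideal_transform_map g (colim_in x)).
rewrite !ideal_transform_mapE -linearD.
by congr (colim_in _); apply: hom_ext => y /=; rewrite hE.
Qed.

Definition ideal_transform : functor R :=
  Functor ideal_transform_id ideal_transform_comp ideal_transform_add.

End IdealTransform.

Section Resolutions.
Variable R : pzRingType.

Definition injective_module (E : lmodType R) : Prop :=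
  forall (A B : lmodType R) (i : {linear A -> B}) (f : {linear A -> E}),
    injective i -> exists g : {linear B -> E}, g \o i =1 f.

Definition projective_module (P : lmodType R) : Prop :=
  forall (A B : lmodType R) (q : {linear A -> B}) (f : {linear P -> B}),
    (forall b, exists a, q a = b) -> exists g : {linear P -> A}, q \o g =1 f.

Record injective_resolution (N : lmodType R) := InjectiveResolution {
  ir_obj :> nat -> lmodType R;
  ir_aug : {linear N -> ir_obj 0%N};
  ir_d : forall i, {linear ir_obj i -> ir_obj i.+1};
  ir_injective : forall i, injective_module (ir_obj i);
  ir_aug_inj : injective ir_aug;
  ir_exact0 : forall x, ir_d 0%N x = 0 <-> exists y, ir_aug y = x;
  ir_exactS : forall i x, ir_d i.+1 x = 0 <-> exists y, ir_d i y = x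
}.

Record projective_resolution (M : lmodType R) := ProjectiveResolution {
  pr_obj :> nat -> lmodType R;
  pr_aug : {linear pr_obj 0%N -> M};
  pr_d : forall i, {linear pr_obj i.+1 -> pr_obj i};
  pr_projective : forall i, projective_module (pr_obj i);
  pr_aug_surj : forall y, exists x, pr_aug x = y;
  pr_exact0 : forall x, pr_aug x = 0 <-> exists y, pr_d 0%N y = x;
  pr_exactS : forall i x, pr_d i x = 0 <-> exists y, pr_d i.+1 y = x
}.

Definition proj_dim_le (M : lmodType R) (n : nat) : Prop :=
  exists P : projective_resolution M,
    forall i, (n < i)%N -> forall x : P i, x = 0.

(* pd(M) is finite and equal to p; the zero module gets p = 0. *)
Definition proj_dim (M : lmodType R) (p : nat) : Prop :=
  proj_dim_le M p /\ forall n, proj_dim_le M n -> (p <= n)%N.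

Variable F : functor R.

Section Derived.
Variables (N : lmodType R) (E : injective_resolution N).

Definition cocycles (i : nat) : submodule (F (E i)) :=
  kersub (fmap F (ir_d E i)).

Definition coboundaries (i : nat) : submodule (F (E i)) :=
  match i with
  | 0 => zerosub (F (E 0%N))
  | k.+1 => imsub (fmap F (ir_d E k))
  end.

(* R^i F(N), computed as H^i(F(E)) from an injective resolution E of N. *)
Definition right_derived (i : nat) : lmodType R :=
  quotmod (subin (cocycles i) (coboundaries i)).

End Derived.
End Resolutions.

Section KrullDim.
Variables (R : comNzRingType) (N : lmodType R).

(* A chain P_0 < ... < P_n of primes of R / Ann N, as primes of R containing  *)
(* Ann N; the library's prime_idealr are proper.                              *)
Definition prime_chain (n : nat) : Prop :=
  exists P : nat -> prime_idealr R,
    (forall i, (i <= n)%N ->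
       forall r : R, (forall x : N, r *: x = 0) -> r \in P i) /\
    (forall i, (i < n)%N ->
       {subset P i <= P i.+1} /\ ~ {subset P i.+1 <= P i}).

(* dim N = dim (R / Ann N) is finite and equal to d; as the zero module has   *)
(* no such chain, it has no finite dimension here.                            *)
Definition krull_dim (d : nat) : Prop :=
  prime_chain d /\ forall n, prime_chain n -> (n <= d)%N.

End KrullDim.

(* Main.v *)
(* R^i D_I(M, N) is the colimit of the groups Ext^i(I^n M, N), computed from an
   injective resolution E of N.

   (i) For N artinian, dimension shifting and Artin-Rees show that every class
   xi in Ext^i(I^n M, N) satisfies (1 - a) xi = 0 on some I^k M, for some a
   in I; in degree 0 this holds because the chains of submodules R x^k y of N
   stabilise. Then xi agrees on I^k M with a^s xi, which extends to M as soon as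
   a^s M lies in I^n M. So the colimit is a quotient of Ext^i(M, N), which is
   artinian.

   (ii) For d = 0, N is artinian and (i) applies. For d > 0 the module is zero:
   by Grothendieck vanishing the complex of I-torsion parts of E, which consists
   of injectives, is exact above degree d, so that maps from M of projective
   dimension p into its cocycles are coboundaries above degree p + d, while
   Ext^(p+d)(M, N) = 0. Grothendieck vanishing is obtained from an ideal spanned
   modulo the annihilator of N by d elements of I, chosen by prime avoidance:
   each new generator costs one degree of cohomology and one step of the chain of
   primes below a prime not containing I. *)

From HB Require Import structures.
Require Import Defs.
From mathcomp Require Import all_boot all_algebra.
From mathcomp Require Import boolp classical_sets.

Section IdealTransformArtinian.

Set Implicit Arguments.
Unset Strict Implicit.
Unset Printing Implicit Defensive.

Import GRing.Theory Defs.
Local Open Scope ring_scope.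

Variable R : comNzRingType.
Implicit Types (U V W E : lmodType R) (J : submodule R^o).

(** * Submodules and linear relations *)

Definition lin_pred V (P : V -> Prop) :=
  P 0 /\ forall a x y, P x -> P y -> P (a *: x + y).

Definition psub_pred V (P : V -> Prop) : {pred V} := [pred x | `[< P x >]].

Lemma psub_predE V (P : V -> Prop) x : (x \in psub_pred P) = `[< P x >].
Proof. by []. Qed.

Fact psub_closed V (P : V -> Prop) : lin_pred P -> submod_closed (psub_pred P).
Proof.
move=> [P0 PD]; split=> [|a x y]; rewrite !psub_predE; first exact/asboolP.
by move=> /asboolP Px /asboolP Py; apply/asboolP/PD.
Qed.

Definition psub V (P : V -> Prop) (h : lin_pred P) : submodule V :=
  Submodule (psub_closed h).

Lemma psubP V (P : V -> Prop) (h : lin_pred P) x : x \in psub h <-> P x.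
Proof. by rewrite psub_predE; split=> /asboolP. Qed.

Lemma sub_lin V (S : submodule V) : lin_pred (fun x => x \in S).
Proof.
split=> [|a x y Sx Sy]; first exact: (rpred0 S).
by apply: rpredD => //; apply: rpredZ.
Qed.

Lemma lin_predI V (P Q : V -> Prop) :
  lin_pred P -> lin_pred Q -> lin_pred (fun x => P x /\ Q x).
Proof.
by move=> [P0 PD] [Q0 QD]; split=> // a x y [? ?] [? ?]; split; auto.
Qed.

Lemma lin_predD V (P : V -> Prop) x y : lin_pred P -> P x -> P y -> P (x + y).
Proof. by move=> [_ PD] Px Py; rewrite -[x]scale1r; apply: PD. Qed.

Lemma lin_predZ V (P : V -> Prop) a x : lin_pred P -> P x -> P (a *: x).
Proof. by move=> [P0 PD] Px; rewrite -[_ *: _]addr0; apply: PD. Qed.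

Lemma lin_predB V (P : V -> Prop) x y : lin_pred P -> P x -> P y -> P (x - y).
Proof.
by move=> h Px Py; rewrite -scaleN1r; apply: lin_predD => //; apply: lin_predZ.
Qed.

(** A submodule of [U * V], used as a partial multivalued map: it stands for homomorphisms between
    subquotients without forming quotient modules. *)
Definition lin_rel U V (r : U -> V -> Prop) :=
  r 0 0 /\ forall a u v u' v', r u v -> r u' v' -> r (a *: u + u') (a *: v + v').

Section RelOps.
Variables (U V : lmodType R) (r : U -> V -> Prop).
Hypothesis lr : lin_rel r.

Lemma lin_relB u v u' v' : r u v -> r u' v' -> r (u - u') (v - v').
Proof using lr.
move=> h h'; have := lr.2 (-1) _ _ _ _ h' h.
by rewrite !scaleN1r ![- _ + _]addrC.
Qed.

Lemma lin_relZ a u v : r u v -> r (a *: u) (a *: v).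
Proof using lr. by move=> h; have := lr.2 a _ _ _ _ h lr.1; rewrite !addr0. Qed.

End RelOps.

Lemma lin_preimZ V (P : V -> Prop) (a : R) :
  lin_pred P -> lin_pred (fun x => P (a *: x)).
Proof.
move=> [P0 PD]; split=> [|b x y Px Py]; first by rewrite scaler0.
by rewrite scalerDr scalerA mulrC -scalerA; apply: PD.
Qed.

Lemma lin_im U V (f : {linear U -> V}) (P : U -> Prop) :
  lin_pred P -> lin_pred (fun y => exists2 x, P x & f x = y).
Proof.
move=> [P0 PD]; split=> [|a _ _ [x Px <-] [y Py <-]].
  by exists 0; rewrite ?raddf0.
by exists (a *: x + y); rewrite ?linearP //; apply: PD.
Qed.

Lemma lin_sum V (P Q : V -> Prop) :
  lin_pred P -> lin_pred Q -> lin_pred (fun x => exists2 y, P y & Q (x - y)).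
Proof.
move=> [P0 PD] [Q0 QD]; split=> [|a x x' [y Py Qy] [y' Py' Qy']].
  by exists 0; rewrite ?subr0.
exists (a *: y + y'); first exact: PD.
by rewrite opprD addrACA -scalerBr; apply: QD.
Qed.

Lemma lin_rel_dom U V (r : U -> V -> Prop) (P : V -> Prop) : lin_rel r ->
  lin_pred P -> lin_pred (fun u => exists2 v, P v & r u v).
Proof.
move=> [r0 rD] [P0 PD]; split=> [|a u u' [v Pv ruv] [v' Pv' ruv']].
  by exists 0.
by exists (a *: v + v'); [apply: PD | apply: rD].
Qed.

Lemma lin_rel_cod U V (r : U -> V -> Prop) (P : U -> Prop) : lin_rel r ->
  lin_pred P -> lin_pred (fun v => exists2 u, P u & r u v).
Proof.
move=> [r0 rD] [P0 PD]; split=> [|a u u' [v Pv ruv] [v' Pv' ruv']].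
  by exists 0.
by exists (a *: v + v'); [apply: PD | apply: rD].
Qed.

Lemma lin_line V (v : V) : lin_pred (fun x => exists c : R, x = c *: v).
Proof.
split=> [|a _ _ [b ->] [c ->]]; first by exists 0; rewrite scale0r.
by exists (a * b + c); rewrite scalerDl scalerA.
Qed.

Lemma ideal_add J (x y : R) : x \in J -> y \in J -> x + y \in J.
Proof. exact: (@rpredD R^o J). Qed.

Lemma ideal_mull J (a x : R) : x \in J -> a * x \in J.
Proof. exact: (@rpredZ _ R^o J). Qed.

Lemma ideal_mulr J (a x : R) : x \in J -> x * a \in J.
Proof. by rewrite mulrC; apply: ideal_mull. Qed.

Lemma ideal_exp J (x : R) n : x \in J -> x ^+ n.+1 \in J.
Proof. by rewrite exprS; apply: ideal_mulr. Qed.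

(** * Noetherian modules *)

Lemma noeth_max V (P : submodule V -> Prop) : noetherian V -> (exists S, P S) ->
  exists2 S, P S & forall T, P T -> {subset S <= T} -> {subset T <= S}.
Proof.
move=> noethV [S0 PS0]; apply: contrapT => nomax.
have next (S : {S | P S}) :
    {T : {S | P S} | {subset sval S <= sval T} /\ ~ {subset sval T <= sval S}}.
  apply: cid; apply: contrapT => noT; apply: nomax; exists (sval S).
    exact: (svalP S).
  move=> T PT sST; apply: contrapT => nsTS.
  by apply: noT; exists (exist _ T PT).
pose S n := iter n (fun S => sval (next S)) (exist _ S0 PS0).
have [n stabS] := noethV (fun n => sval (S n)) (fun n => (svalP (next (S n))).1).
have [_] := svalP (next (S n)); case=> x.
by rewrite -(stabS n.+1 (leqnSn n)).
Qed.

(** Scalars that depend on an element become uniform this way: the submodules killed by the members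
    of a multiplicative set are directed. *)
Lemma noeth_directed V (P : submodule V -> Prop) : noetherian V ->
  (exists S, P S) ->
  (forall S T, P S -> P T ->
     exists Q, [/\ P Q, {subset S <= Q} & {subset T <= Q}]) ->
  exists2 S, P S & forall T, P T -> {subset T <= S}.
Proof.
move=> noethV exP dirP; have [S PS maxS] := noeth_max noethV exP.
exists S => // T PT; have [Q [PQ sSQ sTQ]] := dirP _ _ PS PT.
by move=> x /sTQ; apply: maxS.
Qed.

(* The relation r embeds X / X' into a quotient of W. *)
Lemma noeth_step V W (X X' : submodule V) (r : V -> W -> Prop) : noetherian W ->
  lin_rel r -> (forall v, v \in X -> exists w, r v w) ->
  (forall v, v \in X -> r v 0 -> v \in X') ->
  forall S : nat -> submodule V, (forall n, {subset S n <= S n.+1}) ->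
  (exists n, forall m, (n <= m)%N ->
     forall x, x \in X' -> x \in S m -> x \in S n) ->
  exists n, forall m, (n <= m)%N -> forall x, x \in X -> x \in S m -> x \in S n.
Proof.
move=> noethW lr totr kerr S incS [n1 stab1].
have linT n : lin_pred (fun w => exists2 v, v \in X /\ v \in S n & r v w).
  by apply: lin_rel_cod => //; apply: lin_predI; apply: sub_lin.
have mono m n : (m <= n)%N -> {subset S m <= S n}.
  move=> /subnK <-; elim: (n - m)%N => // k IHk x /IHk; exact: incS.
have [|n2 stab2] := noethW (fun n => psub (linT n)).
  move=> n w /psubP[v [Xv Sv] rvw]; apply/psubP; exists v => //; split=> //.
  exact: incS.
exists (maxn n1 n2) => m; rewrite geq_max => /andP[n1m n2m] x Xx Sx.
have [w rxw] := totr _ Xx.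
have : w \in psub (linT m) by apply/psubP; exists x.
rewrite (stab2 m n2m) => /psubP[v [Xv Sv] rvw].
have Sv' := mono _ _ (leq_maxr n1 n2) _ Sv.
rewrite -(subrK v x) rpredD //; apply: (mono _ _ (leq_maxl n1 n2)).
apply: (stab1 m) => //.
  by apply: kerr; [rewrite rpredB | rewrite -(subrr w); apply: lin_relB].
by rewrite rpredB // (mono _ _ n2m).
Qed.

Definition span_upto V n (g : 'I_n -> V) (k : nat) (x : V) : Prop :=
  exists c : 'I_n -> R, x = \sum_(i < n | (i < k)%N) c i *: g i.

Lemma lin_span_upto V n (g : 'I_n -> V) k : lin_pred (span_upto g k).
Proof.
split=> [|a x y [b ->] [c ->]].
  by exists (fun=> 0); rewrite big1 // => i _; rewrite scale0r.
exists (fun i => a * b i + c i); rewrite scaler_sumr -big_split.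
by apply: eq_bigr => i _; rewrite scalerDl scalerA.
Qed.

(** Filter [V] by the spans of the first [k] generators; each successive quotient is cyclic, so
    [noeth_step] applies with [W = R]. *)
Lemma fin_gen_noeth V : noetherian_ring R -> fin_gen V -> noetherian V.
Proof.
move=> noethR [n [g genV]] S incS.
have mono m k : (m <= k)%N -> {subset S m <= S k}.
  by move=> /subnK <-; elim: (k - m)%N => // l IHl x /IHl; exact: incS.
have stabk k : (k <= n)%N -> exists n0, forall m, (n0 <= m)%N ->
    forall x, x \in psub (lin_span_upto g k) -> x \in S m -> x \in S n0.
  elim: k => [|k IHk] lekn.
    exists 0%N => m _ x /psubP[c ->] _.
    by rewrite big1 ?rpred0.
  pose r (v : V) (c : R^o) := span_upto g k (v - c *: g (Ordinal lekn)).
  apply: (noeth_step (X' := psub (lin_span_upto g k)) (r := r) noethR) => //.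
  - split=> [|a u v u' v' h h']; rewrite /r.
      by rewrite scale0r subr0; apply: (lin_span_upto g k).1.
    rewrite scalerDl opprD addrACA -scalerA -scalerBr.
    exact: (lin_span_upto g k).2.
  - move=> v /psubP[c ->]; exists (c (Ordinal lekn)), c.
    rewrite (bigD1 (Ordinal lekn)) //= addrAC subrr add0r.
    apply: eq_bigl => i; rewrite ltnS -val_eqE /= ltn_neqAle andbC.
    by [].
  - by move=> v _; rewrite /r scale0r subr0 => h; apply/psubP.
  exact: IHk (ltnW lekn).
have [n0 stab] := stabk n (leqnn n); exists n0 => m n0m x.
apply/idP/idP => [|/(mono _ _ n0m)//]; apply: stab => //; apply/psubP.
have [c ->] := genV x; exists c.
by apply: eq_bigl => i; rewrite ltn_ord.
Qed.

(** Take a maximal submodule among those generated by finitely many elements of [S]: adjoining any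
    [x] of [S] cannot enlarge it. *)
Lemma noeth_sub_gen V (S : submodule V) : noetherian V ->
  exists n (s : 'I_n -> V), (forall i, s i \in S) /\
    forall x, x \in S -> exists c : 'I_n -> R, x = \sum_i c i *: s i.
Proof.
move=> noethV.
pose gen (T : submodule V) := exists n (s : 'I_n -> V), (forall i, s i \in S) /\
    forall x, x \in T <-> exists c : 'I_n -> R, x = \sum_i c i *: s i.
have [|T [n [s [sS sT]]] maxT] := noeth_max (P := gen) noethV.
  exists (zerosub V), 0%N, (fun=> 0); split=> [[]//|x].
  rewrite inE; split=> [/eqP->|[c ->]]; last by rewrite big_ord0.
  by exists (fun=> 0); rewrite big_ord0.
exists n, s; split=> // x xS; apply/sT.
have linT := lin_sum (lin_line x) (sub_lin T).
apply: (maxT (psub linT)) => [|y yT|]; last 1 first.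
- by apply/psubP; exists x; [exists 1; rewrite scale1r | rewrite subrr rpred0].
- exists n.+1, (fun i => oapp s x (unlift ord0 i)); split=> [i|y].
    by case: unliftP => [j|] _; [apply: sS | apply: xS].
  split=> [/psubP[_ [c ->] /sT[b yE]]|[c ->]].
    exists (fun i => oapp b c (unlift ord0 i)).
    rewrite big_ord_recl unlift_none /= -[LHS](subrK (c *: x)) yE addrC.
    by congr (_ + _); apply: eq_bigr => i _; rewrite liftK.
  apply/psubP; exists (c ord0 *: x); first by exists (c ord0).
  apply/sT; exists (fun i => c (lift ord0 i)).
  rewrite big_ord_recl unlift_none /= addrC addKr.
  by apply: eq_bigr => i _; rewrite liftK.
apply/psubP; exists 0; last by rewrite subr0.
by exists 0; rewrite scale0r.
Qed.

(** * Extending and lifting maps *)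

(** The graph of [r] is a submodule of [V * E] that projects injectively to [V], and its second
    projection extends along the first. *)
Lemma injective_extend V E (r : V -> E -> Prop) : injective_module E ->
  lin_rel r -> (forall e, r 0 e -> e = 0) ->
  exists g : {linear V -> E}, forall v e, r v e -> g v = e.
Proof.
move=> injE lr r0.
have lP : lin_pred (fun p : (V * E)%type => r p.1 p.2).
  by split=> [|a x y rx ry]; [exact: lr.1 | exact: lr.2].
pose A := submod (psub lP).
pose i : {linear A -> V} := fst \o val.
pose f : {linear A -> E} := snd \o val.
have inj_i : injective i.
  move=> a b eab; apply: val_inj; rewrite [LHS]surjective_pairing.
  rewrite [RHS]surjective_pairing; congr (_, _); first exact: eab.
  have /psubP ra := valP a; have /psubP rb := valP b.
  apply/eqP; rewrite -subr_eq0; apply/eqP/r0.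
  by rewrite -(subrr (val a).1) {2}(eab : (val a).1 = (val b).1); apply: lin_relB.
have [g gi] := injE A V i f inj_i.
exists g => v e rve.
have h : (v, e) \in psub lP by apply/psubP.
exact: (gi (Sub (v, e) h)).
Qed.

Section Corestriction.
Variables (U V : lmodType R) (f : {linear U -> V}) (S : submodule V).
Hypothesis fS : forall x, f x \in S.

Definition corestr (x : U) : submod S := Sub (f x) (fS x).

Fact corestr_linear : linear corestr.
Proof. by move=> a x y; apply: val_inj; rewrite /= !linearP. Qed.

HB.instance Definition _ :=
  GRing.isLinear.Build R U (submod S) _ corestr corestr_linear.
End Corestriction.

Lemma proj_lift U V W (q : {linear V -> W}) (f : {linear U -> W}) :
  projective_module U -> (forall x, exists a, q a = f x) ->
  exists g : {linear U -> V}, forall x, q (g x) = f x.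
Proof.
move=> projU qf.
have qI a : q a \in imsub q by apply/asboolP; exists a.
have fI x : f x \in imsub q by apply/asboolP/qf.
have [|g gE] := projU _ _ (corestr qI : {linear _ -> _})
                          (corestr fI : {linear _ -> _}).
  move=> b; have /asboolP[a qa] := valP b; exists a; exact: val_inj.
by exists g => x; have /(congr1 val) := gE x.
Qed.

Section LinComb.
Variables (V : lmodType R) (n : nat) (s : 'I_n -> V).

Definition lincomb (c : 'rV[R]_n) : V := \sum_i c 0 i *: s i.

Fact lincomb_linear : linear lincomb.
Proof.
move=> a x y; rewrite /lincomb scaler_sumr -big_split; apply: eq_bigr => i _.
by rewrite !mxE scalerDl scalerA.
Qed.

HB.instance Definition _ :=
  GRing.isLinear.Build R 'rV[R]_n V _ lincomb lincomb_linear.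
End LinComb.

Lemma rV_projective n : projective_module 'rV[R]_n.
Proof.
move=> A B q f qsurj.
have [a aE] : {a : 'I_n -> A & forall i, q (a i) = f (delta_mx 0 i)}.
  exact: choice (fun i => qsurj _).
exists (lincomb a : {linear _ -> _}) => v /=.
rewrite {2}[v]row_sum_delta !linear_sum; apply: eq_bigr => i _.
by rewrite !linearZ /= aE.
Qed.

Lemma rV_noeth n : noetherian_ring R -> noetherian 'rV[R]_n.
Proof.
move=> noethR; apply: fin_gen_noeth => //.
exists n, (fun i => delta_mx 0 i) => v; exists (v 0); exact: row_sum_delta.
Qed.

(** * Artin-Rees and powers of ideals *)

(* S / X is killed elementwise by powers of elements of J, with an exponent *)
(* that is uniform on S. *)
Definition cotorsion J V (X S : submodule V) :=
  forall x, x \in J -> exists m, forall v, v \in S -> (x : R) ^+ m *: v \in X.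

(* Weak form of Artin-Rees: L is maximal among the submodules meeting K *)
(* inside X. *)
Lemma artin_rees J V (X K : submodule V) : noetherian V -> cotorsion J X K ->
  exists2 L : submodule V, cotorsion J L (fullsub V) &
    forall v, v \in L -> v \in K -> v \in X.
Proof.
move=> noethV cofX.
pose P (L : submodule V) := (forall v, v \in X -> v \in K -> v \in L) /\
  (forall v, v \in L -> v \in K -> v \in X).
have [|L [XL LK] maxL] := noeth_max (P := P) noethV; first by exists X.
exists L => // x xJ; have [m xmK] := cofX x xJ.
have linS n : lin_pred (fun v => (x : R) ^+ n *: v \in L).
  exact: lin_preimZ (sub_lin L).
have [|n stabS] := noethV (fun n => psub (linS n)).
  move=> n v /psubP xv; apply/psubP.
  by rewrite exprS -scalerA rpredZ.
exists n => v _.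
have linV : lin_pred (fun y => exists w, y = (x : R) ^+ n *: w :> V).
  split=> [|a _ _ [w ->] [w' ->]]; first by exists 0; rewrite scaler0.
  by exists (a *: w + w'); rewrite scalerDr !scalerA mulrC.
(* [L + x ^+ n V] still meets [K] inside [X]: if [w = y + x ^+ n *: z] is in [K], then
   [x ^+ m *: w], hence [x ^+ (m + n) *: z], is in [L], and stability puts [x ^+ n *: z] in [L].
   Maximality then gives [x ^+ n V] inside [L]. *)
have linL := lin_sum (sub_lin L) linV.
apply: (maxL (psub linL)).
- split=> [w wX wK|w /psubP[y yL [z wE]] wK]; first apply/psubP.
    by exists w; [exact: XL | exists 0; rewrite subrr scaler0].
  apply: LK => //; rewrite -(subrK y w); apply: rpredD => //; rewrite wE.
  have: (x : R) ^+ m *: w \in L by apply: XL; [exact: xmK | exact: rpredZ].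
  move=> xwL; have: (x : R) ^+ m *: (w - y) \in L.
    by rewrite scalerBr; apply: rpredB => //; apply: rpredZ.
  rewrite wE scalerA -exprD => h.
  apply/(psubP (linS n)); rewrite -(stabS (m + n)%N) ?leq_addl //.
  exact/psubP.
- by move=> w wL; apply/psubP; exists w => //; exists 0; rewrite subrr scaler0.
by apply/psubP; exists 0; rewrite ?rpred0 //; exists v; rewrite subr0.
Qed.

Lemma idealmulP V J (S : submodule V) v : v \in idealmul J S <->
  exists n (a : 'I_n -> R) (x : 'I_n -> V),
    (forall k, a k \in J /\ x k \in S) /\ v = \sum_k a k *: x k.
Proof. by split=> [/asboolP|h]; last exact/asboolP. Qed.

Lemma idealmul_mem V J (S : submodule V) (a : R) v :
  a \in J -> v \in S -> a *: v \in idealmul J S.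
Proof.
move=> aJ vS; apply/idealmulP; exists 1%N, (fun=> a), (fun=> v).
by rewrite big_ord1.
Qed.

Lemma idealmul_le V J (S T : submodule V) :
  (forall (a : R) v, a \in J -> v \in S -> a *: v \in T) ->
  {subset idealmul J S <= T}.
Proof.
move=> h _ /idealmulP[n [a [x [ax ->]]]]; apply: rpred_sum => k _.
by apply: h; have [] := ax k.
Qed.

Lemma idealpow_expr J (x : R) n : x \in J -> x ^+ n \in idealpow J n.
Proof.
by move=> xJ; elim: n => //= n IHn; rewrite exprS; apply: (idealmul_mem xJ IHn).
Qed.

Lemma idealpow_add J i j (B : submodule R^o) :
  (forall a b : R, a \in idealpow J i -> b \in idealpow J j -> a * b \in B) ->
  {subset idealpow J (i + j) <= B}.
Proof.
elim: i B => [|i IHi] B h x xJ; first by rewrite -[x]mul1r; apply: h.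
move: x xJ; rewrite addSn; apply: idealmul_le => a v aJ.
have linB := lin_preimZ a (sub_lin B).
move=> vJ; apply/(psubP linB); move: v vJ; apply: IHi => b c bJ cJ.
apply/(psubP linB); rewrite [a *: _]mulrA.
by apply: h => //; apply: (idealmul_mem aJ).
Qed.

(** In a maximal counterexample [B], some [x] of [J] outside [B] has its square in [B]. The ideals
    [B + R x] and [B : x] are larger, so they contain powers of [J], and their product lies in
    [B]. *)
Lemma ideal_nil_pow J (A : submodule R^o) : noetherian_ring R ->
  (forall x : R, x \in J -> exists m, x ^+ m \in A) ->
  exists k, {subset idealpow J k <= A}.
Proof.
move=> noethR nilA; apply: contrapT => badA.
pose bad (B : submodule R^o) := (forall x : R, x \in J -> exists m, x ^+ m \in B)
  /\ ~ exists k, {subset idealpow J k <= B}.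
have [|B [nilB badB] maxB] := noeth_max (P := bad) noethR; first by exists A.
have [y yJ yB] : exists2 y : R, y \in J & y \notin B.
  apply: contrapT => h; apply: badB; exists 1%N.
  move=> x /idealmulP[n [a [z [az ->]]]]; apply: rpred_sum => k _.
  apply: ideal_mulr; apply: contrapT => /negP aB; apply: h; exists (a k) => //.
  by have [] := az k.
have [x [xJ xB x2B]] : exists x : R, [/\ x \in J, x \notin B & x * x \in B].
  have exm := nilB y yJ; case: (ex_minnP exm) => -[|[|m]] ymB minm.
  - by case/negP: yB; rewrite -[y]mulr1; apply: ideal_mull.
  - by case/negP: yB.
  exists (y ^+ m.+1); split; first exact: ideal_exp.
    by apply/negP => /minm; rewrite ltnn.
  by rewrite -exprD addSnnS exprD; apply: ideal_mull.
have lin1 := lin_sum (sub_lin B) (lin_line (x : R^o)).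
have lin2 := lin_preimZ x (sub_lin B).
have good (C : submodule R^o) : {subset B <= C} -> x \in C ->
    exists k, {subset idealpow J k <= C}.
  move=> sBC xC; apply: contrapT => badC; case/negP: xB.
  apply: (maxB C) => //; split=> // z /nilB[m zB]; exists m; exact: sBC.
have [||k1 pow1] := good (psub lin1).
- move=> z zB; apply/(psubP lin1); exists z => //.
  by exists 0; rewrite subrr scale0r.
- apply/(psubP lin1); exists 0; first exact: rpred0.
  by exists 1; rewrite scale1r subr0.
have [||k2 pow2] := good (psub lin2).
- by move=> z zB; apply/(psubP lin2); apply: rpredZ.
- exact/(psubP lin2).
apply: badB; exists (k1 + k2)%N; apply: idealpow_add => a b.
move=> /pow1/psubP[a' a'B [c aE]] /pow2/psubP xbB.
rewrite -[a](subrK a') mulrDl; apply: ideal_add; last exact: ideal_mulr.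
by rewrite [a - a']aE -mulrA; apply: ideal_mull.
Qed.

Lemma cotorsion_pow J V (L : submodule V) : noetherian_ring R ->
  cotorsion J L (fullsub V) -> exists k, {subset idealpow_mod J V k <= L}.
Proof.
move=> noethR cofL.
have linA : lin_pred (fun r : R^o => forall v, (r : R) *: v \in L).
  split=> [v|a x y xL yL v]; first by rewrite scale0r rpred0.
  by rewrite scalerDl -scalerA; apply: (sub_lin L).2.
have [|k powk] := ideal_nil_pow (J := J) (A := psub linA) noethR.
  by move=> x /cofL[m xm]; exists m; apply/(psubP linA) => v; apply: xm.
by exists k; apply: idealmul_le => a v /powk/psubP aL _; apply: aL.
Qed.

Lemma pow_cofin J V n : cotorsion J (idealpow_mod J V n) (fullsub V).
Proof.
move=> x xJ; exists n => v _; apply: idealmul_mem => //.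
exact: idealpow_expr.
Qed.

Lemma cotorsion_trans J V (X Y Z : submodule V) :
  cotorsion J X Y -> cotorsion J Y Z -> cotorsion J X Z.
Proof.
move=> XY YZ x xJ; have [m xm] := XY x xJ; have [n xn] := YZ x xJ.
by exists (m + n)%N => v vZ; rewrite exprD -scalerA; apply/xm/xn.
Qed.

(** * Cohomology of restricted maps *)

(* The subquotient Z / B is artinian. *)
Definition artinian_between V (B Z : submodule V) := forall S : nat -> submodule V,
  (forall n, {subset S n.+1 <= S n}) -> (forall n, {subset S n <= Z}) ->
  (forall n, {subset B <= S n}) -> exists n, forall m, (n <= m)%N -> S m =i S n.

Lemma antimono V (S : nat -> submodule V) : (forall n, {subset S n.+1 <= S n}) ->
  forall m n, (m <= n)%N -> {subset S n <= S m}.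
Proof.
move=> decS m n /subnK <-; elim: (n - m)%N => // k IHk x.
by rewrite addSn => /decS; apply: IHk.
Qed.

Lemma artinian_full_between V :
  artinian V -> artinian_between (zerosub V) (fullsub V).
Proof. by move=> artV S decS _ _; apply: artV. Qed.

Lemma artinian_between_full V :
  artinian_between (zerosub V) (fullsub V) -> artinian V.
Proof.
by move=> artV S decS; apply: artV => // n x /eqP ->; apply: (rpred0 (S n)).
Qed.

(** The relation makes [Z / B] a subquotient of [Z' / B']: a chain [S] is compared with the traces
    on [Z'] of the sums [B' + r(S n)]. *)
Lemma artinian_between_transfer U W (B Z : submodule U) (B' Z' : submodule W)
    (r : U -> W -> Prop) :
  lin_rel r -> {subset B' <= Z'} -> artinian_between B' Z' ->
  (forall v, v \in Z -> exists2 w, w \in Z' & r v w) ->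
  (forall v w, v \in Z -> w \in B' -> r v w -> v \in B) -> artinian_between B Z.
Proof.
move=> lr sBZ' art' totr kerr S decS sSZ sBS.
have linT n : lin_pred (fun w => w \in Z' /\
    exists2 b, b \in B' & exists2 v, v \in S n & r v (w - b)).
  apply: lin_predI; first exact: sub_lin.
  exact: lin_sum (sub_lin B') (lin_rel_cod lr (sub_lin (S n))).
have [|n w /psubP[]//|n b bB'|n stabT] := art' (fun n => psub (linT n)).
- move=> n w /psubP[wZ [b bB' [v /decS vS rvw]]]; apply/psubP; split=> //.
  by exists b => //; exists v.
- apply/psubP; split; first exact: sBZ'.
  by exists b => //; exists 0; [exact: rpred0 | rewrite subrr; apply: lr.1].
exists n => m nm x; apply/idP/idP; first exact: (antimono decS).
move=> xS; have [w wZ' rxw] := totr _ (sSZ _ _ xS).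
have: w \in psub (linT n).
  apply/psubP; split=> //; exists 0; first exact: rpred0.
  by exists x; rewrite ?subr0.
rewrite -(stabT m nm) => /psubP[_ [b bB' [v vS rvw]]].
rewrite -(subrK v x); apply: rpredD => //; apply: (sBS m).
apply: (kerr _ b) => //; first by apply: rpredB; apply: sSZ; eassumption.
by have := lin_relB lr rxw rvw; rewrite subKr.
Qed.

(** By the modular law, a descending chain is stable once its intersections with [X] and its sums
    with [X] are. *)
Lemma artinian_between_trans V (B X Z : submodule V) : {subset B <= X} ->
  {subset X <= Z} -> artinian_between B X -> artinian_between X Z ->
  artinian_between B Z.
Proof.
move=> sBX sXZ artBX artXZ S decS sSZ sBS.
have linI n := lin_predI (sub_lin (S n)) (sub_lin X).
have linD n := lin_sum (sub_lin (S n)) (sub_lin X).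
have [n x /psubP[/decS xS xX]|n x /psubP[]//|n x xB|n1 stabI] :=
  artBX (fun n => psub (linI n)).
- exact/psubP.
- by apply/psubP; split; [exact: sBS | exact: sBX].
have [n x /psubP[y /decS yS xyX]|n x /psubP[y yS xyX]|n x xX|n2 stabD] :=
  artXZ (fun n => psub (linD n)).
- by apply/psubP; exists y.
- by rewrite -(subrK y x); apply: rpredD; [exact: sXZ | apply: sSZ; eassumption].
- by apply/psubP; exists 0; [exact: rpred0 | rewrite subr0].
exists (maxn n1 n2) => m; rewrite geq_max => /andP[n1m n2m] x.
apply/idP/idP; first by apply: (antimono decS); rewrite geq_max n1m.
move=> xS; have xS1 := antimono decS (leq_maxl n1 n2) xS.
have xS2 := antimono decS (leq_maxr n1 n2) xS.
have: x \in psub (linD n2).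
  by apply/psubP; exists x; rewrite ?subrr //; apply: rpred0.
rewrite -(stabD m n2m) => /psubP[y yS xyX].
rewrite -(subrK y x); apply: rpredD => //.
have: x - y \in psub (linI n1).
  by apply/psubP; split=> //; apply: rpredB => //; apply: (antimono decS n1m).
by rewrite -(stabI m n1m) => /psubP[].
Qed.

Section Cohomology.
Variables (N : lmodType R) (E : injective_resolution N).

Lemma ir_dd i x : ir_d E i.+1 (ir_d E i x) = 0.
Proof. by apply/(ir_exactS (i := i)); exists x. Qed.

(* Since the E i are injective, a map S -> E i is the restriction of a map *)
(* f : V -> E i; the cohomology of Hom(S, E), i.e. Ext^i(S, N), is computed *)
(* from these total maps, which avoids subtypes. *)
Definition cocycle V (S : submodule V) i (f : hom V (E i)) : Prop :=
  forall x, x \in S -> ir_d E i (f x) = 0.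

Definition coboundary V (S : submodule V) i : hom V (E i) -> Prop :=
  match i with
  | 0 => fun f => forall x, x \in S -> f x = 0
  | k.+1 => fun f =>
      exists g : hom V (E k), forall x, x \in S -> f x = ir_d E k (g x)
  end.

Lemma lin_cocycle V (S : submodule V) i : lin_pred (@cocycle V S i).
Proof.
split=> [x _|a f g fZ gZ x xS] /=; first by rewrite raddf0.
by rewrite linearP fZ // gZ // scaler0 addr0.
Qed.

Lemma lin_coboundary V (S : submodule V) i : lin_pred (@coboundary V S i).
Proof.
case: i => [|i]; split => [|a f g].
- by [].
- by move=> fB gB x xS /=; rewrite fB // gB // scaler0 addr0.
- by exists 0 => x _ /=; rewrite raddf0.
move=> [f' fE] [g' gE]; exists (a *: f' + g') => x xS /=.
by rewrite linearP fE // gE.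
Qed.

Lemma coboundary_cocycle V (S : submodule V) i (f : hom V (E i)) :
  coboundary S f -> cocycle S f.
Proof.
case: i f => [|i] f; first by move=> f0 x xS; rewrite f0 ?raddf0.
by move=> [g fE] x xS; rewrite fE // ir_dd.
Qed.

Lemma coboundary0 V (S : submodule V) i (f : hom V (E i)) :
  (forall x, x \in S -> f x = 0) -> coboundary S f.
Proof.
by case: i f => [|i] f f0 //; exists 0 => x /f0 ->; rewrite raddf0.
Qed.

Lemma coboundary_sub V (S T : submodule V) i (f : hom V (E i)) :
  {subset T <= S} -> coboundary S f -> coboundary T f.
Proof.
case: i f => [|i] f sTS; first by move=> f0 x /sTS; apply: f0.
by move=> [g fE]; exists g => x /sTS; apply: fE.
Qed.

(* Dimension shifting along 0 -> ker q -> U -> V -> 0, restricted to T. *)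
Lemma coboundary_shift U V (q : {linear U -> V}) (T K : submodule U)
    (S : submodule V) i (g : hom U (E i)) (f : hom V (E i.+1)) :
  (forall t, t \in T -> ir_d E i (g t) = f (q t)) ->
  (forall t, t \in T -> q t = 0 -> t \in K) -> coboundary K g ->
  (forall v, v \in S -> exists2 t, t \in T & q t = v) -> coboundary S f.
Proof.
move=> dg TK Kg ST.
(* Subtracting [d h], where [g = d h] on [K], makes [g] vanish on [K] without changing [d g]; the
   result descends along [q]. *)
have [g1 g1K dg1] : exists2 g1 : hom U (E i), (forall t, t \in K -> g1 t = 0) &
    (forall t, ir_d E i (g1 t) = ir_d E i (g t)).
  case: i g f dg Kg => [|i] g f _; first by exists g.
  move=> [h gE]; exists (g \- (ir_d E i \o h) : {linear _ -> _}) => t /=.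
    by move=> /gE ->; rewrite subrr.
  by rewrite linearB /= ir_dd subr0.
pose r (v : V) (e : E i) := exists2 t, t \in T & v = q t /\ e = g1 t.
have lr : lin_rel r.
  split=> [|a _ _ _ _ [t tT [-> ->]] [t' t'T [-> ->]]].
    by exists 0; rewrite ?raddf0 //; apply: rpred0.
  by exists (a *: t + t'); [exact: (sub_lin T).2 | rewrite !linearP].
have [|g2 g2E] := injective_extend (@ir_injective _ _ E i) lr.
  by move=> e [t tT [/esym q0 ->]]; apply/g1K/TK.
exists g2 => v /ST[t tT <-]; rewrite (g2E _ (g1 t)); last by exists t.
by rewrite dg1 dg.
Qed.

Lemma cocycle_lift V n (s : 'I_n -> V) (S : submodule V) i (f : hom V (E i.+1)) :
  cocycle S f -> (forall k, s k \in S) -> exists g : hom 'rV[R]_n (E i),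
    forall t, ir_d E i (g t) = f (lincomb s t).
Proof.
move=> fZ sS; apply: (proj_lift (f := f \o lincomb s : {linear _ -> _})).
  exact: rV_projective.
move=> t /=; apply/ir_exactS/fZ.
by apply: rpred_sum => k _; apply: rpredZ.
Qed.

(* By dimension shifting along a free cover of S; Artin-Rees compares the *)
(* filtration of its kernel with the one induced by the cover. *)
Lemma torsion_coboundary J (P : R -> Prop) : noetherian_ring R ->
  (forall V (S : submodule V) (f : hom V (E 0%N)), noetherian V -> cocycle S f ->
     exists u, P u /\ exists2 X, cotorsion J X S & coboundary X (u *: f)) ->
  forall i V (S : submodule V) (f : hom V (E i)), noetherian V -> cocycle S f ->
     exists u, P u /\ exists2 X, cotorsion J X S & coboundary X (u *: f).
Proof.
move=> noethR base; elim=> [|i IHi] V S f noethV fZ; first exact: base.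
have [n [s [sS genS]]] := noeth_sub_gen S noethV.
have [g gE] := cocycle_lift fZ sS.
pose q : {linear 'rV[R]_n -> V} := lincomb s.
have [|u [Pu [X cofX gB]]] := IHi _ (kersub q) g (rV_noeth noethR).
  by move=> t /eqP qt; rewrite gE qt raddf0.
have [L cofL LX] := artin_rees (rV_noeth noethR) cofX.
have linI := lin_im q (sub_lin L).
exists u; split=> //; exists (psub linI) => [x /cofL[m xm]|].
  exists m => v /genS[c ->]; apply/psubP.
  exists (x ^+ m *: \row_k c k); first exact: xm.
  rewrite linearZ; congr (_ *: _); apply: eq_bigr => k _; by rewrite mxE.
apply: (coboundary_shift (q := q) (T := L) (K := X) (g := u *: g)) => //.
- by move=> t _ /=; rewrite linearZ gE.
- by move=> t tL qt; apply: LX => //; apply/eqP.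
- by move=> v /psubP.
Qed.

Definition cocyc V (S : submodule V) i : submodule (hom V (E i)) :=
  psub (@lin_cocycle V S i).
Definition cobound V (S : submodule V) i : submodule (hom V (E i)) :=
  psub (@lin_coboundary V S i).

Lemma cobound_cocyc V (S : submodule V) i :
  {subset cobound S i <= cocyc S i}.
Proof. by move=> f /psubP fB; apply/psubP/coboundary_cocycle. Qed.

(** In degree 0, cocycles take values in the image of [N] and are determined on [S] by their values
    at [n] generators, so the cohomology embeds in [N^n]. Higher degrees follow by shifting along a
    free cover of [S]. *)
Lemma cohomology_artinian : noetherian_ring R -> artinian N ->
  forall i V (S : submodule V), noetherian V ->
    artinian_between (cobound S i) (cocyc S i).
Proof.
move=> noethR artN; elim=> [|i IHi] V S noethV.
all: have [n [s [sS genS]]] := noeth_sub_gen S noethV.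
  (* Vanishing at the first [k] generators defines a filtration whose successive quotients embed in
     [N]. *)
  have linB k : lin_pred (fun f : hom V (E 0%N) =>
      f \in cocyc S 0 /\ forall j : 'I_n, (j < k)%N -> f (s j) = 0).
    apply: lin_predI; first exact: sub_lin.
    split=> [//|a f g f0 g0 j jk] /=; by rewrite f0 // g0 // scaler0 addr0.
  have art k : (k <= n)%N -> artinian_between (psub (linB k)) (cocyc S 0).
    elim: k => [_|k IHk lekn] T decT sTZ sBT.
      exists 0%N => m _ f; apply/idP/idP => /sTZ fZ; apply: sBT; exact/psubP.
    have sub1 : {subset psub (linB k.+1) <= psub (linB k)}.
      move=> f /psubP[fZ f0]; apply/psubP; split=> // j jk.
      by apply: f0; apply: ltnW.
    apply: (artinian_between_trans (X := psub (linB k))) decT sTZ sBT => //.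
    - by move=> f /psubP[].
    - pose r (f : hom V (E 0%N)) y := ir_aug E y = f (s (Ordinal lekn)).
      apply: (artinian_between_transfer (r := r))
        (artinian_full_between artN) _ _ => //.
      + split=> [|a f y g z fy gz]; first by rewrite /r raddf0.
        by rewrite /r linearP fy gz.
      + move=> f /psubP[/psubP fZ _].
        by have /ir_exact0[y fE] := fZ _ (sS (Ordinal lekn)); exists y.
      move=> f y /psubP[fZ f0] /eqP y0 rfy; apply/psubP; split=> // j.
      rewrite ltnS leq_eqVlt => /orP[/eqP jk|/f0 //].
      have -> : j = Ordinal lekn by apply: val_inj.
      by rewrite -rfy y0 raddf0.
    exact: (IHk (ltnW lekn)).
  move=> T decT sTZ sBT; apply: (art n) => // m f /psubP[fZ f0]; apply: sBT.
  apply/psubP => _ /genS[c ->]; rewrite linear_sum big1 // => k _.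
  by rewrite linearZ /= f0 // scaler0.
pose q : {linear 'rV[R]_n -> V} := lincomb s.
pose r (f : hom V (E i.+1)) (g : hom 'rV[R]_n (E i)) :=
  forall t, ir_d E i (g t) = f (q t).
apply: (artinian_between_transfer (r := r)) (@cobound_cocyc _ _ _)
  (IHi _ (kersub q) (rV_noeth noethR)) _ _.
- split=> [t|a f g f' g' h h' t] /=; first by rewrite raddf0.
  by rewrite linearP h h'.
- move=> f /psubP fZ; have [g gE] := cocycle_lift fZ sS.
  by exists g => //; apply/psubP => t /eqP qt; rewrite gE qt raddf0.
move=> f g /psubP fZ /psubP gB rfg; apply/psubP.
apply: (coboundary_shift (q := q) (T := fullsub _)) gB _ => // [t _ /eqP //|].
move=> v /genS[c ->]; exists (\row_k c k) => //.
by apply: eq_bigr => k _; rewrite mxE.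
Qed.

End Cohomology.

(** * Derived functors of the ideal transform *)

Lemma quotmod_proj0 V (S : submodule V) : quotmod_proj S 0 = 0.
Proof. by apply: (addrI (quotmod_proj S 0)); rewrite -quotmod_projD !addr0. Qed.

Lemma quotmod_proj_eq0 V (S : submodule V) x : quotmod_proj S x = 0 <-> x \in S.
Proof. by rewrite -(quotmod_proj0 S) -{2}[x]subr0; apply: quotmod_proj_eq. Qed.

Lemma quotmod_proj_linear V (S : submodule V) a x y :
  quotmod_proj S (a *: x + y) = a *: quotmod_proj S x + quotmod_proj S y.
Proof. by rewrite quotmod_projD -quotmod_scaleE. Qed.

Lemma submod_val_linear V (S : submodule V) a (x y : submod S) :
  val (a *: x + y) = a *: val x + val y.
Proof. exact: linearP. Qed.

Lemma submod_valZ V (S : submodule V) a (x : submod S) :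
  val (a *: x) = a *: val x.
Proof. exact: linearZ. Qed.

Lemma submod_valB V (S : submodule V) (x y : submod S) :
  val (x - y) = val x - val y.
Proof. exact: raddfB. Qed.

Section Transform.
Variables (I : submodule R^o) (M N : lmodType R) (E : injective_resolution N).
Let D := ideal_transform I M.

(** As [E i] is injective, every element of its ideal transform comes from a map on all of [M]; [n]
    only selects the stage of the colimit. *)
Definition germ i n (f : hom M (E i)) : D (E i) :=
  colim_in (precomp (val : {linear submod (idealpow_mod I M n) -> M}) f
            : transform_sys I M (E i) n).

Fact germ_linear i n : linear (@germ i n).
Proof.
by move=> a f g; rewrite /germ linearP; apply: (linearP (@colim_in R _ n)).
Qed.

HB.instance Definition _ i n :=
  GRing.isLinear.Build R (hom M (E i)) (D (E i)) _ (@germ i n) (@germ_linear i n).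

Lemma germB i n (f g : hom M (E i)) : germ n (f - g) = germ n f - germ n g.
Proof. exact: raddfB. Qed.

Lemma germ_eq0 i n (f : hom M (E i)) : germ n f = germ 0 f.
Proof.
rewrite /germ -(colim_in_map (leq0n n)); congr (colim_in _).
by apply: hom_ext => x.
Qed.

Lemma germ_d i n (f : hom M (E i)) :
  fmap D (ir_d E i) (germ n f) = germ n (postcomp (ir_d E i) f).
Proof.
by rewrite [LHS]ideal_transform_mapE; congr (colim_in _); apply: hom_ext.
Qed.

(** The differential of a representative vanishes in the colimit, hence already on some [I^n M];
    injectivity of [E i] extends the representative to [M]. *)
Lemma germP i (c : D (E i)) : c \in cocycles D E i ->
  exists n (f : hom M (E i)), c = germ 0 f /\ cocycle (idealpow_mod I M n) f.
Proof.
have [m [phi ->]] := colimP c; move=> /eqP; rewrite [LHS]ideal_transform_mapE.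
rewrite -[RHS](raddf0 (@colim_in _ (transform_sys I M (E i.+1)) m)).
move=> /colim_in_eq[n [mn [mn' dphi]]].
have [|f fE] := @ir_injective _ _ E i _ _ (val : {linear _ -> M}) phi.
  exact: val_inj.
exists n, f; split.
  rewrite -(germ_eq0 m) /germ; congr (colim_in _); apply: hom_ext => x.
  by rewrite -fE.
move=> x xI; pose y := incl (idealpow_mod_sub mn) (Sub x xI).
have dphi0 : ir_d E i (phi y) = 0.
  exact: (congr1 (fun h : hom _ _ => h (Sub x xI)) dphi).
by rewrite -fE in dphi0.
Qed.

Lemma germ_cocycle i (f : hom M (E i)) : cocycle (fullsub M) f ->
  germ 0 f \in cocycles D E i.
Proof.
move=> fZ; apply/eqP; rewrite germ_d.
have -> : postcomp (ir_d E i) f = 0 by apply: hom_ext => x; apply: fZ.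
exact: raddf0.
Qed.

Lemma germ_coboundary i n (f : hom M (E i)) :
  coboundary (idealpow_mod I M n) f -> germ 0 f \in coboundaries D E i.
Proof.
rewrite -(germ_eq0 n); case: i f => [|i] f.
  move=> f0; apply/eqP; rewrite /germ.
  rewrite -[RHS](raddf0 (@colim_in _ (transform_sys I M (E 0%N)) n)).
  by congr (colim_in _); apply: hom_ext => x; apply: f0; exact: (valP x).
move=> [g fE]; apply/asboolP; exists (germ n g); rewrite germ_d.
by congr (colim_in _); apply: hom_ext => x /=; rewrite fE //; exact: (valP x).
Qed.

(** The second hypothesis says that every class in the colimit comes from [Ext^i(M, N)], so the
    derived functor is a quotient of that artinian module. *)
Lemma right_derived_artinian i :
  artinian_between (cobound E (fullsub M) i) (cocyc E (fullsub M) i) ->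
  (forall n (f : hom M (E i)), cocycle (idealpow_mod I M n) f ->
     exists2 f' : hom M (E i), cocycle (fullsub M) f' &
       exists k, coboundary (idealpow_mod I M k) (f - f')) ->
  artinian (right_derived D E i).
Proof.
move=> art approx.
pose B := subin (cocycles D E i) (coboundaries D E i).
pose r (u : quotmod B) (f : hom M (E i)) :=
  exists2 w, u = quotmod_proj B w & val w = germ 0 f.
apply: (@artinian_between_full (quotmod B)).
apply: (artinian_between_transfer (r := r)) (@cobound_cocyc _ _ _ _ _) art _ _.
- split=> [|a _ f _ f' [w -> wE] [w' -> w'E]].
    by exists 0; rewrite ?raddf0 // quotmod_proj0.
  exists (a *: w + w'); last by rewrite germ_linear -wE -w'E submod_val_linear.
  by rewrite quotmod_proj_linear.
- move=> u _; have [w ->] := quotmod_projP u.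
  have [n [f [wE /approx[f' f'Z [k fB]]]]] := germP (valP w).
  exists f'; first exact/psubP.
  pose w' : submod (cocycles D E i) := Sub (germ 0 f') (germ_cocycle f'Z).
  exists w' => //; apply/quotmod_proj_eq; rewrite inE.
  have -> : val (w - w') = germ 0 (f - f') by rewrite submod_valB germB wE.
  exact: germ_coboundary fB.
move=> _ f _ /psubP fB [w -> wE]; apply/eqP.
apply/quotmod_proj_eq0; rewrite inE wE.
apply: (@germ_coboundary _ 0); exact: coboundary_sub fB.
Qed.

End Transform.

(** * Artinian coefficients and part (i) *)

Lemma comaximalM J (u v : R) : 1 - u \in J -> 1 - v \in J -> 1 - u * v \in J.
Proof.
move=> uJ vJ; have -> : 1 - u * v = (1 - u) + u * (1 - v).
  by rewrite mulrBr mulr1 addrA subrK.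
by apply: ideal_add => //; apply: ideal_mull.
Qed.

Lemma comaximal1 J : (1 : R) - 1 \in J.
Proof. by rewrite subrr; apply: (rpred0 J). Qed.

Section ArtinianCoefficients.
Variables (N : lmodType R) (E : injective_resolution N).
Hypothesis artN : artinian N.

(** The chain of submodules [R x ^+ n y] stabilises. So [1 - c * x], which is 1 modulo any ideal
    containing [x], kills [x ^+ n *: y]. *)
Lemma artinian_stab (x : R) (y : N) :
  exists n c, x ^+ n *: y = (c * x) *: (x ^+ n *: y).
Proof using artN.
have [m z /psubP[c ->]|n stabn] := @artN (fun n => psub (lin_line (x ^+ n *: y))).
  by apply/psubP; exists (c * x); rewrite exprS -!scalerA.
have: x ^+ n *: y \in psub (lin_line (x ^+ n *: y)).
  by apply/psubP; exists 1; rewrite scale1r.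
rewrite -(stabn n.+1) // => /psubP[c h]; exists n, c.
by rewrite {1}h exprS -!scalerA.
Qed.

Lemma artinian_torsion J V (S : submodule V) (f : hom V (E 0%N)) :
  noetherian V -> cocycle S f ->
  exists u : R, 1 - u \in J /\ exists2 X, cotorsion J X S & coboundary X (u *: f).
Proof using artN.
move=> noethV fZ.
have lin0 (u : R) : lin_pred (fun v => u *: f v = 0).
  split=> [|a v w v0 w0]; first by rewrite raddf0 scaler0.
  by rewrite linearP scalerDr scalerA mulrC -scalerA v0 w0 scaler0 addr0.
have one (x : R) : x \in J -> exists m (u : R), 1 - u \in J /\
    forall v, v \in S -> x ^+ m *: (u *: f v) = 0.
  (* The kernels of the maps [(x ^+ m * u) *: f] are directed; the greatest one makes [m] and [u]
     independent of [v]. *)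
  move=> xJ; pose P (T : submodule V) := exists m (u : R), 1 - u \in J /\
    forall v, v \in T <-> (x ^+ m * u) *: f v = 0.
  have [||T [m [u [uJ TE]]] maxT] := noeth_directed (P := P) noethV.
  - exists (psub (lin0 1)), 0%N, 1; split=> [|v]; first exact: comaximal1.
    by rewrite mul1r; exact: psubP.
  - move=> T T' [m [u [uJ TE]]] [m' [u' [u'J T'E]]].
    exists (psub (lin0 ((x ^+ m * u) * (x ^+ m' * u')))); split.
    + exists (m + m')%N, (u * u'); split=> [|v]; first exact: comaximalM.
      by rewrite exprD mulrACA; exact: psubP.
    + by move=> v /TE v0; apply/psubP; rewrite mulrC -scalerA v0 scaler0.
    + by move=> v /T'E v0; apply/psubP; rewrite -scalerA v0 scaler0.
  exists m, u; split=> // v vS; rewrite scalerA; apply/TE.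
  have /ir_exact0[y yE] := fZ v vS; have [n [c xyE]] := artinian_stab x y.
  apply: (maxT (psub (lin0 (x ^+ n * (1 - c * x))))).
    exists n, (1 - c * x); split; last by move=> w; exact: psubP.
    by rewrite opprB addrC subrK; apply: ideal_mull.
  apply/psubP; rewrite -yE -linearZ mulrC -scalerA scalerBl scale1r.
  by rewrite -xyE subrr raddf0.
(* The greatest kernel of a map [u *: f] makes [u] independent of [x] as well. *)
pose P (T : submodule V) := exists u : R, 1 - u \in J /\
  forall v, v \in T <-> u *: f v = 0.
have [||X [u [uJ XE]] maxX] := noeth_directed (P := P) noethV.
- exists (psub (lin0 1)), 1; split=> [|v]; first exact: comaximal1.
  by exact: psubP.
- move=> T T' [u [uJ TE]] [u' [u'J T'E]].
  exists (psub (lin0 (u * u'))); split.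
  + exists (u * u'); split=> [|v]; first exact: comaximalM.
    by exact: psubP.
  + by move=> v /TE v0; apply/psubP; rewrite mulrC -scalerA v0 scaler0.
  + by move=> v /T'E v0; apply/psubP; rewrite -scalerA v0 scaler0.
exists u; split=> //; exists X; last by move=> v /XE.
move=> x /one[m [u' [u'J u'S]]]; exists m => v vS.
apply: (maxX (psub (lin0 u'))); first by exists u'; split=> // w; exact: psubP.
by apply/psubP; rewrite linearZ scalerA mulrC -scalerA u'S.
Qed.

End ArtinianCoefficients.

Lemma transform_artinian (I : submodule R^o) (M N : lmodType R)
    (E : injective_resolution N) i : noetherian_ring R -> fin_gen M ->
  artinian N -> artinian (right_derived (ideal_transform I M) E i).
Proof.
move=> noethR fgM artN; have noethM := fin_gen_noeth noethR fgM.
apply: right_derived_artinian; first exact: cohomology_artinian.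
move=> n f fZ.
have [u [uI [X cofX uB]]] := torsion_coboundary (J := I)
  (P := fun u : R => 1 - u \in I) noethR (@artinian_torsion N E artN I) noethM fZ.
(* As [a] is in [I], [a ^+ s] sends [M] into [I^n M], so [a ^+ s *: f] is a cocycle on [M]. Since
   [1 - a ^+ s] is a multiple of [u], it differs from [f] by a coboundary on some [I^k M]. *)
pose a := 1 - u; have [s as_n] := @pow_cofin I M n a uI.
exists (a ^+ s *: f).
  by move=> x xM; have := fZ _ (as_n x xM); rewrite linearZ.
have [k powk] := cotorsion_pow noethR (cotorsion_trans cofX (@pow_cofin I M n)).
exists k; apply: coboundary_sub powk _.
have -> : f - a ^+ s *: f = (\sum_(j < s) a ^+ j) *: (u *: f).
  rewrite scalerA -{1}[f]scale1r -scalerBl; congr (_ *: _).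
  by rewrite -opprB subrX1 -opprB mulNr opprK mulrC subKr.
exact: lin_predZ (lin_coboundary _ _ _) uB.
Qed.

(** * Injectivity of torsion submodules *)

Lemma lin_rel_fun U V (r : U -> V -> Prop) : lin_rel r ->
  (forall v, r 0 v -> v = 0) -> (forall u, exists v, r u v) ->
  exists g : {linear U -> V}, forall u, r u (g u).
Proof.
move=> lr fr tr; have [g gE] := choice tr.
have gP u v : r u v -> v = g u.
  move=> ruv; apply/eqP; rewrite -subr_eq0; apply/eqP/fr.
  by rewrite -(subrr u); apply: lin_relB.
have lg : linear g by move=> a u v; apply/esym/gP/lr.2.
pose h : {linear U -> V} := HB.pack g (GRing.isLinear.Build R U V _ g lg).
by exists h.
Qed.

(** Baer's criterion, where [r] is the graph of a map from an ideal to [E]. Zorn's lemma is applied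
    to graphs in [B * E]. *)
Lemma baer E :
  (forall r : R^o -> E -> Prop, lin_rel r -> (forall e, r 0 e -> e = 0) ->
     exists e, forall (x : R) y, r x y -> y = x *: e) ->
  injective_module E.
Proof.
move=> ext A B i f inj_i.
pose good (X : set (B * E)) := [/\ lin_rel (fun b e => X (b, e)),
  forall e, X (0, e) -> e = 0 & forall a, X (i a, f a)].
(* Zorn_bigcup also asks for the union of the empty chain *)
pose P : set (set (B * E)) := fun X => (exists z, X z) -> good X.
have [F FP totF [z [X0 FX0 X0z]]|X [PX maxX]] := @Zorn_bigcup _ P.
  have goodF Y z' : F Y -> Y z' -> good Y by move=> /FP PY Yz; apply: PY; exists z'.
  have [lX0 _ fX0] := goodF _ _ FX0 X0z; split.
  - split=> [|a u v u' v' [Y FY Yu] [Y' FY' Yu']].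
      by exists X0 => //; apply: lX0.1.
    have [sYY'|sY'Y] := totF _ _ FY FY'.
      exists Y' => //; have [lY' _ _] := goodF _ _ FY' Yu'.
      by apply: (lY'.2 a) => //; apply: sYY'.
    exists Y => //; have [lY _ _] := goodF _ _ FY Yu.
    by apply: (lY.2 a) => //; apply: sY'Y.
  - by move=> e [Y FY Ye]; have [_ + _] := goodF _ _ FY Ye; apply.
  - by move=> a; exists X0.
have [|lX funX graphX] := PX.
  (* The empty set satisfies [P] vacuously; were [X] empty, the graph of [f] over [i] would exceed
     it. *)
  apply: contrapT => X0.
  apply: (maxX (fun z => exists a, z = (i a, f a))).
    split=> [z Xz|sGX]; first by case: X0; exists z.
    by case: X0; exists (i 0, f 0); apply: sGX; exists 0.
  move=> _; split=> [|e [a [/esym ia0 ->]]|a]; last by exists a.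
    split=> [|a u v u' v' [b [-> ->]] [b' [-> ->]]].
      by exists 0; rewrite !raddf0.
    by exists (a *: b + b'); rewrite !linearP.
  by have -> : a = 0 by [apply: inj_i; rewrite raddf0]; rewrite raddf0.
have totX b : exists e, X (b, e).
  (* The ideal of those [x] with [x *: b] in the domain of [X] maps to [E]; extending this map gives
     a value [e0] at [b], and [Y] is [X + R (b, e0)]. *)
  have [||e0 e0E] := ext (fun x e => X (x *: b, e)).
  - split=> [|a x e x' e' Xe Xe']; first by rewrite scale0r; apply: lX.1.
    by rewrite scalerDl -scalerA; apply: lX.2.
  - by move=> e; rewrite scale0r; apply: funX.
  exists e0; pose Y (z : B * E) := exists x, X (z.1 - x *: b, z.2 - x *: e0).
  apply: contrapT => nXb; apply: (maxX Y).
    split=> [[u v] Xuv|sYX]; first by exists 0; rewrite !scale0r !subr0.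
    by apply/nXb/sYX; exists 1; rewrite !scale1r !subrr; apply: lX.1.
  move=> _; split=> [|e [x /=]|a].
  - split=> [|a u v u' v' [x Xx] [x' Xx']].
      by exists 0; rewrite !scale0r !subr0; apply: lX.1.
    have combE V (w w' c : V) : (a *: w + w') - (a * x + x') *: c =
        a *: (w - x *: c) + (w' - x' *: c).
      by rewrite scalerDl opprD addrACA -scalerA -scalerBr.
    by exists (a * x + x'); rewrite /= !combE; apply: lX.2.
  - rewrite /= sub0r -(scaleNr x b) => Xe; have /eqP := e0E _ _ Xe.
    by rewrite scaleNr -subr_eq0 opprK subrK => /eqP.
  by exists 0; rewrite !scale0r !subr0; apply: graphX.
have [g gE] := lin_rel_fun lX funX totX.
exists g => a; apply/eqP; rewrite -subr_eq0; apply/eqP/funX.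
by rewrite -(subrr (i a)); apply: (lin_relB lX (gE (i a)) (graphX a)).
Qed.

(** Over a noetherian ring this agrees with being killed by a power of [J]. *)
Definition torsion J V (v : V) : Prop :=
  forall x : R, x \in J -> exists m, x ^+ m *: v = 0.

Lemma expr_scale0 V (x : R) (v : V) m n :
  x ^+ m *: v = 0 -> (m <= n)%N -> x ^+ n *: v = 0.
Proof. by move=> v0 /subnK <-; rewrite exprD -scalerA v0 scaler0. Qed.

Lemma lin_torsion J V : lin_pred (@torsion J V).
Proof.
split=> [x _|a u v tu tv x xJ]; first by exists 0%N; rewrite scaler0.
have [m um] := tu x xJ; have [n vn] := tv x xJ; exists (maxn m n).
rewrite scalerDr scalerA mulrC -scalerA.
rewrite (expr_scale0 um) ?leq_maxl // (expr_scale0 vn) ?leq_maxr //.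
by rewrite scaler0 addr0.
Qed.

Definition torsub J V : submodule V := psub (@lin_torsion J V).

Lemma torsion_lin J U V (f : {linear U -> V}) u : torsion J u -> torsion J (f u).
Proof.
by move=> tu x /tu[m um]; exists m; rewrite -linearZ /= um raddf0.
Qed.

(** For fixed [x], the submodules sent into [X] by [x ^+ m] increase with [m] and stabilise, so one
    exponent serves all of [S]. *)
Lemma cotorsion_full J V (X : submodule V) (S : submodule V) : noetherian V ->
  (forall v, v \in S -> forall x : R, x \in J -> exists m, x ^+ m *: v \in X) ->
  cotorsion J X S.
Proof.
move=> noethV tor x xJ.
pose lin m := lin_preimZ (V := V) (x ^+ m) (sub_lin X).
have [m v /psubP xv|n stabn] := noethV (fun m => psub (lin m)).
  by apply/psubP; rewrite exprS -scalerA; apply: rpredZ.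
exists n => v vS; have [m xv] := tor v vS x xJ.
apply/(psubP (lin n)); rewrite -(stabn (maxn m n)) ?leq_maxr //.
apply/psubP; rewrite -(subnK (leq_maxl m n)) exprD -scalerA.
exact: rpredZ.
Qed.

(** The kernel of a map from an ideal to the torsion part is cotorsion in the ideal, so Artin-Rees
    gives [L], cotorsion in [R], that meets the ideal inside the kernel. Extended by 0 on [L], then
    to [R] with values in [E], the map sends 1 to a torsion element. *)
Lemma torsion_injective J E : noetherian_ring R -> injective_module E ->
  injective_module (submod (torsub J E)).
Proof.
move=> noethR injE; apply: baer => r lr fr.
have linD : lin_pred (fun x => exists2 y, True & r x y).
  exact: (lin_rel_dom lr (conj I (fun _ _ _ _ _ => I))).
have linX : lin_pred (fun x => r x 0).
  split=> [|a x y rx ry]; first exact: lr.1.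
  by have := lr.2 a _ _ _ _ rx ry; rewrite scaler0 addr0.
have cofX : cotorsion J (psub linX) (psub linD).
  apply: cotorsion_full => // v /psubP[y _ rvy] x xJ.
  have /psubP/(_ x xJ)[m xy] := valP y; exists m; apply/psubP.
  have -> : 0 = x ^+ m *: y by apply: val_inj; rewrite submod_valZ.
  exact: lin_relZ.
have [L cofL LX] := artin_rees noethR cofX.
pose r' (x : R^o) (e : E) := exists l y, [/\ l \in L, r (x - l) y & e = val y].
have lr' : lin_rel r'.
  split=> [|a u _ u' _ [l [y [lL ry ->]]] [l' [y' [l'L ry' ->]]]].
    by exists 0, 0; rewrite subr0; split=> //; [exact: rpred0 | exact: lr.1].
  exists (a *: l + l'), (a *: y + y'); split; last by rewrite submod_val_linear.
    exact: (sub_lin L).2.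
  by rewrite opprD addrACA -scalerBr; apply: lr.2.
have [|g gE] := injective_extend injE lr'.
  move=> _ [l [y [lL ry ->]]]; rewrite sub0r in ry.
  have l0 : r (- l) 0.
    apply/(psubP linX); apply: LX; first by rewrite rpredN.
    by apply/psubP; exists y.
  rewrite -(subrr (val y)) -[X in _ = _ - X]subr0.
  have -> : y = 0.
    by apply: fr; rewrite -(subrr (- l)) -[y]subr0; apply: lin_relB.
  by rewrite raddf0 !subr0.
have g1 : g (1 : R) \in torsub J E.
  apply/psubP => x xJ; have [m xm] := cofL x xJ; exists m.
  rewrite -linearZ; apply: gE; exists (x ^+ m *: (1 : R^o)), 0.
  by rewrite subrr raddf0; split=> //; [exact: xm | exact: lr.1].
pose e : submod (torsub J E) := Sub (g (1 : R)) g1.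
exists e => x y rxy; apply: val_inj; rewrite submod_valZ.
have -> : x *: val e = g x by rewrite -[x in RHS]mulr1 [RHS](linearZ_LR g x).
apply/esym/gE.
by exists 0, y; rewrite subr0; split=> //; apply: rpred0.
Qed.

(** * Projective dimension *)

Lemma proj_dim_le0 (M : lmodType R) : proj_dim_le M 0 -> projective_module M.
Proof.
move=> [P P0].
have aug_inj x : pr_aug P x = 0 -> x = 0.
  by move=> /pr_exact0[y <-]; rewrite (P0 1%N _ y) ?raddf0.
have lr : lin_rel (fun m x => pr_aug P x = m).
  by split=> [|a m x m' x' <- <-]; rewrite ?raddf0 // linearP.
have [s sE] := lin_rel_fun lr aug_inj (@pr_aug_surj _ _ P).
move=> A B q f qsurj.
have [g gE] := pr_projective (f \o pr_aug P : {linear _ -> _}) qsurj.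
by exists (g \o s : {linear _ -> _}) => m /=; rewrite [LHS]gE /= sE.
Qed.

Section Syzygy.
Variables (M : lmodType R) (P : projective_resolution M).
Let K := kersub (pr_aug P).

Fact syzygy_aug x : pr_d P 0 x \in K.
Proof. by apply/eqP/pr_exact0; exists x. Qed.

Fact syzygy_surj (y : submod K) :
  exists x, (corestr syzygy_aug : {linear P 1%N -> submod K}) x = y.
Proof. by have /eqP/pr_exact0[x xE] := valP y; exists x; apply: val_inj. Qed.

Fact syzygy_exact0 x :
  (corestr syzygy_aug : {linear P 1%N -> submod K}) x = 0 <->
  exists y, pr_d P 1 y = x.
Proof.
rewrite -pr_exactS; split=> [/(congr1 val)//|x0].
exact: val_inj.
Qed.

Definition syzygy_resolution : projective_resolution (submod K) :=
  @ProjectiveResolution R (submod K) (fun i => P i.+1) (corestr syzygy_aug)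
    (fun i => pr_d P i.+1) (fun i => @pr_projective _ _ P i.+1) syzygy_surj
    syzygy_exact0 (fun i => @pr_exactS _ _ P i.+1).
End Syzygy.

Lemma proj_dim_leS (M : lmodType R) p : proj_dim_le M p.+1 ->
  exists (P : lmodType R) (q : {linear P -> M}),
    [/\ projective_module P, forall y, exists x, q x = y
      & proj_dim_le (submod (kersub q)) p].
Proof.
move=> [P P0]; exists (P 0%N), (pr_aug P); split.
- exact: pr_projective.
- exact: pr_aug_surj.
by exists (syzygy_resolution P) => i pi x; apply: P0.
Qed.

(** By induction on [p]: lift [f \o q] to a map [g] on the projective cover. On the syzygy [g] is a
    cocycle one degree lower, hence some [d h]; extend [h] by injectivity, and [g - d h'] descends
    to [M]. *)
Lemma pd_coboundary (C : nat -> lmodType R)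
    (d : forall i, {linear C i -> C i.+1}) c :
  (forall i, injective_module (C i)) -> (forall i x, d i.+1 (d i x) = 0) ->
  (forall i x, (c <= i)%N -> d i.+1 x = 0 -> exists y, d i y = x) ->
  forall p (M : lmodType R), proj_dim_le M p -> forall i (f : hom M (C i.+1)),
    (c + p <= i)%N -> (forall x, d i.+1 (f x) = 0) ->
    exists g : hom M (C i), forall x, f x = d i (g x).
Proof.
move=> injC dd exC; elim=> [|p IHp] M.
  move=> /proj_dim_le0 projM i f; rewrite addn0 => ci df.
  have [|g gE] := proj_lift (q := d i) (f := f) projM.
    by move=> x; apply: exC.
  by exists g => x; rewrite gE.
move=> /proj_dim_leS[P [q [projP qsurj pdK]]] [|i] f; rewrite addnS // ltnS.
move=> ci df.
have [|g gE] := proj_lift (q := d i.+1) (f := f \o q : {linear _ -> _}) projP.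
  by move=> x; apply: exC => //=; rewrite (leq_trans (leq_addr p c)) // ltnW.
have [|h hE] := IHp _ pdK i (g \o val : {linear _ -> _}) ci.
  by move=> x /=; rewrite gE /= (eqP (valP x)) raddf0.
have [|h' h'E] := injC i _ _ (val : {linear submod (kersub q) -> P}) h.
  exact: val_inj.
pose g1 : {linear P -> C i.+1} := g \- (d i \o h').
pose r m e := exists x, q x = m /\ e = g1 x.
have lr : lin_rel r.
  split=> [|a _ _ _ _ [x [<- ->]] [x' [<- ->]]].
    by exists 0; rewrite !raddf0.
  by exists (a *: x + x'); rewrite !linearP.
have [||k kE] := lin_rel_fun lr.
- move=> _ [x [/eqP qx ->]]; have := hE (Sub x qx); rewrite /= => ->.
  by rewrite -h'E subrr.
- by move=> m; have [x <-] := qsurj m; exists (g1 x), x.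
exists k => m; have [x [<- ->]] := kE m.
by rewrite linearB /= dd subr0 gE.
Qed.

(** * The torsion subcomplex and positive dimension *)

Section TorsionComplex.
Variables (J : submodule R^o) (N : lmodType R) (E : injective_resolution N).

(** The local cohomology of [N] with support in [J] vanishes above degree [c]: the element lies in
    degree [i.+1], so [c <= i] is the strict bound. *)
Definition torsion_exact c := forall i (z : E i.+1), (c <= i)%N ->
  torsion J z -> ir_d E i.+1 z = 0 -> exists2 w, torsion J w & ir_d E i w = z.

Definition tors_obj i : lmodType R := submod (torsub J (E i)).

Fact tors_d_subproof i (x : tors_obj i) :
  ir_d E i (val x) \in torsub J (E i.+1).
Proof. by have /psubP tx := valP x; apply/psubP/torsion_lin. Qed.

Definition tors_d i : {linear tors_obj i -> tors_obj i.+1} :=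
  corestr (f := ir_d E i \o val : {linear _ -> _}) (@tors_d_subproof i).

End TorsionComplex.

(* For a cocycle f on I^n M, the total map d f takes torsion values, hence is *)
(* d g with g torsion-valued; f - g is then a cocycle on M, so a coboundary. *)
Lemma right_derived_pd (I : submodule R^o) (M N : lmodType R)
    (E : injective_resolution N) p d : noetherian_ring R -> fin_gen M ->
  proj_dim_le M p -> torsion_exact I E d -> (0 < d)%N ->
  artinian (right_derived (ideal_transform I M) E (p + d)).
Proof.
move=> noethR fgM pdM texI d_gt0; have noethM := fin_gen_noeth noethR fgM.
apply: right_derived_artinian.
  (* As [d > 0], the degree exceeds [p], so [Ext^(p+d)(M, N)] vanishes. *)
  have sZB : {subset cocyc E (fullsub M) (p + d) <= cobound E (fullsub M) (p + d)}.
    have : (p < p + d)%N by rewrite -addn1 leq_add2l.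
    case: (p + d)%N => // i; rewrite ltnS => pi f /psubP fZ; apply/psubP.
    have [|||||g gE] := @pd_coboundary E (ir_d E) 0 _ _ _ p M pdM i f.
    - exact: ir_injective.
    - exact: ir_dd.
    - by move=> k x _ /ir_exactS.
    - by [].
    - by move=> x; apply: fZ.
    by exists g => x _.
  move=> S decS sSZ sBS; exists 0%N => m _ f.
  by apply/idP/idP => /sSZ/sZB/sBS.
move=> n f fZ.
have dfI x : ir_d E (p + d) (f x) \in torsub I (E (p + d).+1).
  apply/psubP => y yI; have [m ym] := @pow_cofin I M n y yI; exists m.
  by rewrite -!linearZ fZ // ym.
pose df : {linear M -> submod (torsub I (E (p + d).+1))} :=
  corestr (f := ir_d E (p + d) \o f : {linear _ -> _}) dfI.
have [||||| g gE] := @pd_coboundary (tors_obj I E) (tors_d I E) d _ _ _ p M pdM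
  (p + d)%N df.
- by move=> i; apply: torsion_injective => //; apply: ir_injective.
- by move=> i x; apply: val_inj; rewrite /= ir_dd.
- move=> i x di /(congr1 val)/= dx; have /psubP tx := valP x.
  have [w tw wE] := texI i _ di tx dx.
  have wT : w \in torsub I (E i) by apply/psubP.
  by exists (Sub w wT); apply: val_inj.
- by rewrite addnC.
- by move=> x; apply: val_inj; rewrite /= ir_dd.
pose g' : hom M (E (p + d)) := (val \o g : {linear _ -> _}).
exists (f - g') => [x _|].
  by have /(congr1 val)/= := gE x; rewrite linearB /= => ->; rewrite subrr.
(* Since [M] is noetherian and [g'] has torsion values, [g'] vanishes on some [I^k M]. *)
have cofK : cotorsion I (kersub g') (fullsub M).
  apply: cotorsion_full => // v _ x xI; have /psubP/(_ x xI)[m xm] := valP (g v).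
  by exists m; apply/eqP; rewrite linearZ.
have [k powk] := cotorsion_pow noethR cofK; exists k; rewrite subKr.
by apply: coboundary0 => x /powk/eqP.
Qed.

(** * Prime ideals *)

Definition is_prime (P : submodule R^o) : Prop := (1 : R) \notin P /\
  forall a b : R, a * b \in P -> a \in P \/ b \in P.

Lemma prime_exp (P : submodule R^o) (x : R) n : is_prime P ->
  x ^+ n \in P -> x \in P.
Proof.
move=> [P1 PM]; elim: n => [|n IHn]; first by rewrite expr0 (negPf P1).
by rewrite exprS => /PM[].
Qed.

Section PrimeOf.
Variables (P : submodule R^o) (hP : is_prime P).

Fact prime_of_idealr : idealr_closed (submodule_pred P : {pred R}).
Proof using hP.
split; [exact: (rpred0 P) | exact: hP.1 |].
by move=> a u v uP vP; apply: ideal_add => //; apply: ideal_mull.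
Qed.

Fact prime_of_prime : prime_idealr_closed (submodule_pred P : {pred R}).
Proof using hP. by move=> u v /hP.2[] ->; rewrite ?orbT. Qed.

Definition prime_of : prime_idealr R :=
  HB.pack (submodule_pred P : R -> bool)
    (isIdealr.Build R _ prime_of_idealr)
    (isPrimeIdealrClosed.Build R _ prime_of_prime).
End PrimeOf.

Lemma prime_ofE P (hP : is_prime P) (x : R) : (x \in prime_of hP) = (x \in P).
Proof. by []. Qed.

Definition adjoin_pred J (x y : R) : Prop := exists c : R, y - c * x \in J.

Fact lin_adjoin J x : @lin_pred R^o (adjoin_pred J x).
Proof.
split=> [|a y y' [c yJ] [c' y'J]].
  by exists 0; rewrite mul0r subrr; apply: (rpred0 J).
exists (a * c + c'); have -> : a *: (y : R^o) + y' - (a * c + c') * x =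
    a * (y - c * x) + (y' - c' * x).
  by rewrite mulrBr mulrDl opprD addrACA mulrA.
by apply: ideal_add => //; apply: ideal_mull.
Qed.

Definition adjoin J (x : R) : submodule R^o := psub (lin_adjoin J x).

Lemma adjoinP J (x y : R) : y \in adjoin J x <-> exists c : R, y - c * x \in J.
Proof. exact: (psubP (lin_adjoin J x)). Qed.

Lemma adjoin_sub J (x : R) : {subset J <= adjoin J x}.
Proof. by move=> y yJ; apply/adjoinP; exists 0; rewrite mul0r subr0. Qed.

Lemma adjoin_mem J (x : R) : x \in adjoin J x.
Proof. by apply/adjoinP; exists 1; rewrite mul1r subrr; apply: (rpred0 J). Qed.

Lemma adjoin_le J (x : R) (K : submodule R^o) :
  {subset J <= K} -> x \in K -> {subset adjoin J x <= K}.
Proof.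
move=> sJK xK y /adjoinP[c /sJK yK]; rewrite -[y](subrK (c * x)).
by apply: ideal_add => //; apply: ideal_mull.
Qed.

(** Take [P] maximal among the ideals over [J] missing [T]. For [a] and [b] outside [P], both
    [P + R a] and [P + R b] meet [T]; if [a * b] were in [P], so would be the product of the two
    members of [T]. *)
Lemma prime_disjoint J (T : R -> Prop) : noetherian_ring R -> T 1 ->
  (forall a b, T a -> T b -> T (a * b)) -> (forall a, T a -> a \notin J) ->
  exists P, [/\ is_prime P, {subset J <= P} & forall a, T a -> a \notin P].
Proof.
move=> noethR T1 TM TJ.
pose good (Q : submodule R^o) := {subset J <= Q} /\ forall a, T a -> a \notin Q.
have [|P [JP TP] maxP] := noeth_max (P := good) noethR; first by exists J; split.
exists P; split=> //; split=> [|a b abP]; first exact: TP.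
have meet (x : R) : x \notin P -> exists2 t, T t & exists c, t - c * x \in P.
  move=> xP; apply: contrapT => h; case/negP: xP.
  apply: (maxP (adjoin P x)); last exact: adjoin_mem; last exact: adjoin_sub.
  split=> [y /JP yP|t Tt]; first exact: adjoin_sub.
  by apply/negP => /adjoinP[c tP]; apply: h; exists t => //; exists c.
have [aP|/meet[t Tt [c tP]]] := boolP (a \in P); first by left.
have [bP|/meet[t' Tt' [c' t'P]]] := boolP (b \in P); first by right.
have /negP[] := TP _ (TM _ _ Tt Tt').
rewrite -[t](subrK (c * a)) mulrDl; apply: ideal_add; first exact: ideal_mulr.
rewrite -[t'](subrK (c' * b)) mulrDr; apply: ideal_add; first exact: ideal_mull.
by rewrite mulrACA; apply: ideal_mull.
Qed.

(** A substitute for the minimal primes over [J]; repetitions and non-minimal members are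
    allowed. *)
Definition prime_cover J n (Q : 'I_n -> submodule R^o) : Prop :=
  (forall i, is_prime (Q i) /\ {subset J <= Q i}) /\
  forall P, is_prime P -> {subset J <= P} -> exists i, {subset Q i <= P}.

(** A maximal counterexample [K] is proper and not prime, so it contains some [a * b] with neither
    factor in [K]; covers of [K + R a] and [K + R b] together cover [K]. *)
Lemma prime_coverP J : noetherian_ring R ->
  exists n (Q : 'I_n -> submodule R^o), prime_cover J Q.
Proof.
move=> noethR; apply: contrapT => badJ.
pose bad K := ~ exists n (Q : 'I_n -> submodule R^o), prime_cover K Q.
have [|K badK maxK] := noeth_max (P := bad) noethR; first by exists J.
have good (x : R) : x \notin K -> 
    exists n (Q : 'I_n -> submodule R^o), prime_cover (adjoin K x) Q.
  move=> xK; apply: contrapT => badKx; case/negP: xK.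
  apply: (maxK (adjoin K x)) => //; [exact: adjoin_sub | exact: adjoin_mem].
have K1 : (1 : R) \notin K.
  apply/negP => K1; apply: badK; exists 0%N, (fun=> K); split=> [[]//|P [P1 _] sKP].
  by case/negP: P1; apply: sKP.
have [a [b [abK aK bK]]] : exists a b : R,
    [/\ a * b \in K, a \notin K & b \notin K].
  apply: contrapT => primeK; apply: badK; exists 1%N, (fun=> K); split=> [_|P _ ?].
    split=> //; split=> // a b abK; apply: contrapT => nab; apply: primeK.
    exists a, b; split=> //; apply/negP => h; apply: nab; [by left | by right].
  by exists ord0.
have [n [Q [Qp QP]]] := good a aK; have [m [Q' [Q'p Q'P]]] := good b bK.
apply: badK; exists (n + m)%N.
exists (fun i => match split i with inl j => Q j | inr j => Q' j end).
split=> [i|P].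
  case: (split i) => j.
    by have [? sQ] := Qp j; split=> // x xK; apply/sQ/adjoin_sub.
  by have [? sQ] := Q'p j; split=> // x xK; apply/sQ/adjoin_sub.
move=> Pp sKP; have [aP|bP] := Pp.2 a b (sKP _ abK).
  have [i sQP] := QP P Pp (adjoin_le sKP aP).
  by exists (lshift m i); rewrite (unsplitK (inl _ i)).
have [i sQP] := Q'P P Pp (adjoin_le sKP bP).
by exists (rshift n i); rewrite (unsplitK (inr _ i)).
Qed.

Lemma prime_avoidance J n (Q : 'I_n -> submodule R^o) (A : {set 'I_n}) :
  (forall i, is_prime (Q i)) ->
  (forall i, i \in A -> exists2 y : R, y \in J & y \notin Q i) ->
  exists2 x : R, x \in J & forall i, i \in A -> x \notin Q i.
Proof.
move=> Qp; have [m] := ubnP #|A|; elim: m A => // m IHm A Am AJ.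
have [[i [j [iA jA ij sQji]]]|noinc] :=
    pselect (exists i j, [/\ i \in A, j \in A, i != j & {subset Q j <= Q i}]).
  have [||x xJ xA] := IHm (A :\ j); first by rewrite (cardsD1 j) jA in Am.
    by move=> k /setD1P[_ /AJ].
  exists x => // k kA; have [->|kj] := eqVneq k j; last by apply: xA; apply/setD1P.
  apply/negP => /sQji; apply/negP/xA; exact/setD1P.
have [->|[i iA]] := set_0Vmem A.
  by exists 0 => [|i]; [exact: (rpred0 J) | rewrite inE].
have [||x xJ xA] := IHm (A :\ i); first by rewrite (cardsD1 i) iA in Am.
  by move=> k /setD1P[_ /AJ].
have [xi|xi] := boolP (x \in Q i); last first.
  exists x => // k kA; have [-> //|ki] := eqVneq k i; by apply: xA; apply/setD1P.
have [t tE] : {t : 'I_n -> R & forall j, j \in A :\ i ->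
    t j \in Q j /\ t j \notin Q i}.
  apply: (@choice _ _ (fun j (y : R) => j \in A :\ i -> y \in Q j /\ y \notin Q i)).
  move=> j; apply: contrapT => h; have /setD1P[ji jA] : j \in A :\ i.
    by apply: contrapT => jA; apply: h; exists 0.
  apply: noinc; exists i, j; split=> //; first by rewrite eq_sym.
  move=> y yj; apply: contrapT => /negP yi; apply: h; by exists y.
have [y yJ yi] := AJ i iA.
(* [u] lies in [J] and in every other prime but not in [Q i], so adding it to [x] repairs avoidance
   at [i] only. *)
pose u := y * \prod_(j in A :\ i) t j.
have ui : u \notin Q i.
  have [Q1 QM] := Qp i; apply/negP => /QM[]; apply/negP => //.
  elim/big_ind: _ => // [a b aQ bQ|j /tE[] //].
  by apply/negP => /QM[]; apply/negP.
exists (x + u).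
  by apply: ideal_add => //; apply: ideal_mulr.
move=> k kA; apply/negP; have [-> xui|ki xuk] := eqVneq k i.
  by case/negP: ui; rewrite -[u](addKr x) addrC; apply: (@rpredB R^o (Q i)).
have kAi : k \in A :\ i by apply/setD1P.
have /negP[] := xA k kAi; rewrite -[x](addrK u); apply: (@rpredB R^o (Q k)) => //.
by rewrite /u (bigD1 k) //=; apply/ideal_mull/ideal_mulr; have [] := tE k kAi.
Qed.

Lemma expr_scale_add V (v : V) (a b : R) m n :
  a ^+ m *: v = 0 -> b ^+ n *: v = 0 -> (a + b) ^+ (m + n) *: v = 0.
Proof.
elim: m n v => [|m IHm] n v; first by rewrite expr0 scale1r => ->; rewrite !scaler0.
elim: n v => [|n IHn] v av bv.
  by move: bv; rewrite expr0 scale1r => ->; rewrite !scaler0.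
have comm (c d : R) k : c ^+ k *: (d *: v) = d *: (c ^+ k *: v).
  by rewrite !scalerA mulrC.
rewrite addSn exprSr -scalerA scalerDl scalerDr IHm ?add0r //.
- rewrite addnS -addSn; apply: IHn; first by rewrite comm av scaler0.
  by rewrite scalerA -exprSr.
- by rewrite scalerA -exprSr.
by rewrite comm bv scaler0.
Qed.

Lemma torsion_adjoin J (x : R) V (v : V) : torsion J v ->
  (exists m, x ^+ m *: v = 0) -> torsion (adjoin J x) v.
Proof.
move=> tv [m xv] y /adjoinP[c /tv[n yv]]; exists (n + m)%N.
rewrite -[y](subrK (c * x)); apply: expr_scale_add => //.
by rewrite exprMn -scalerA xv scaler0.
Qed.

Lemma torsion_sub J (K : submodule R^o) V (v : V) :
  {subset J <= K} -> torsion K v -> torsion J v.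
Proof. by move=> sJK tv x /sJK/tv. Qed.

Section OrbitMap.
Variables (V : lmodType R) (v : V).

Definition orbit_map (r : R^o) : V := (r : R) *: v.

Fact orbit_map_linear : linear orbit_map.
Proof. by move=> a x y; rewrite /orbit_map scalerDl -scalerA. Qed.

HB.instance Definition _ :=
  GRing.isLinear.Build R R^o V _ orbit_map orbit_map_linear.
End OrbitMap.

(** * Grothendieck vanishing *)

Section Vanishing.
Variables (N : lmodType R) (E : injective_resolution N).
Hypothesis noethR : noetherian_ring R.

Fact lin_ann : @lin_pred R^o (fun r => forall x : N, (r : R) *: x = 0).
Proof.
split=> [x|a r s r0 s0 x]; first by rewrite scale0r.
by rewrite scalerDl -scalerA r0 s0 scaler0 addr0.
Qed.

Definition ann : submodule R^o := psub lin_ann.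

Lemma annP (r : R) : r \in ann <-> forall x : N, r *: x = 0.
Proof. exact: (psubP lin_ann). Qed.

(** In degree 0 the values of [f] come from [N], so [ann] kills them. Taking [eq 1] as the condition
    on scalars propagates this to all degrees without multiplying [f]. *)
Lemma ann_coboundary i V (S : submodule V) (f : hom V (E i)) :
  noetherian V -> cocycle S f -> exists2 X, cotorsion ann X S & coboundary X f.
Proof using noethR.
move=> noethV fZ.
have [|u [<- [X cofX]]] :=
    torsion_coboundary (J := ann) (P := eq 1) noethR _ noethV fZ.
  move=> {i} {}V {}S {}f {}noethV {}fZ; exists 1; split=> //.
  exists (kersub f) => [r /annP r0|v /eqP fv] /=; last by rewrite fv scaler0.
  exists 1%N => v vS; apply/eqP; rewrite linearZ /=.
  have /ir_exact0[y <-] := fZ v vS.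
  by rewrite -linearZ /= r0 raddf0.
by rewrite scale1r; exists X.
Qed.

(** Write [z = d y]. On the annihilator of [z] the map sending [r] to [r *: y] is a cocycle, hence a
    coboundary [d g] on some [X] cotorsion in [R]; then [y - d (g 1)] is torsion. In degree 0, [y]
    itself is. *)
Lemma torsion_exact_ann : torsion_exact ann E 0.
Proof using noethR.
move=> i z _ tz dz; have /ir_exactS[y yE] := dz.
have [|X cofX yB] := @ann_coboundary i R^o (kersub (orbit_map z))
  (orbit_map y : {linear R^o -> E i}) noethR.
  by move=> r /eqP rz; rewrite linearZ yE.
have cofX1 : cotorsion ann X (fullsub R^o).
  apply: (cotorsion_trans cofX) => x /tz[m xz]; exists m => r _.
  by apply/eqP; rewrite linearZ /= /orbit_map scalerA mulrC -scalerA xz scaler0.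
case: i z tz dz y yE cofX yB => [|i] z tz dz y yE _.
  move=> y0; exists y => // x /cofX1[m xm]; exists m.
  by have := y0 _ (xm 1 isT); rewrite /= /orbit_map [_ *: 1]mulr1.
move=> [g gE]; exists (y - ir_d E i (g (1 : R))); last first.
  by rewrite linearB /= ir_dd subr0.
move=> x /cofX1[m xm]; exists m; rewrite scalerBr -!linearZ /=.
by rewrite -(gE _ (xm 1 isT)) /= /orbit_map [_ *: 1]mulr1 subrr.
Qed.

(** With [z = d w] and [x ^+ k *: z = 0], the cocycle [x ^+ k *: w] is some [d v]. A [J]-torsion [e]
    with [x ^+ (k + l) *: e = x ^+ l *: v] makes [w - d e] killed by [x ^+ (k + l)]. *)
Lemma torsion_exact_adjoin J (x : R) c :
  torsion_exact J E c -> torsion_exact (adjoin J x) E c.+1.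
Proof using noethR.
move=> exJ [//|i] z ci tz dz.
have [w tw wE] := exJ _ z (ltnW ci) (torsion_sub (@adjoin_sub J x) tz) dz.
have [k xk] := tz x (adjoin_mem J x).
have [||v tv vE] := exJ i (x ^+ k *: w) ci.
- exact: lin_predZ (lin_torsion _ _) tw.
- by rewrite linearZ /= wE.
have lin0 n : @lin_pred R^o (fun r => x ^+ n *: r = 0).
  apply: (@lin_preimZ R^o (fun r => r = 0)).
  by split=> // a r s -> ->; rewrite scaler0 addr0.
have [n r /psubP xr|l stabl] := @noethR (fun n => psub (lin0 n)).
  by apply/psubP; rewrite exprS -scalerA xr scaler0.
pose v1 : submod (torsub J (E i)) := Sub v ((psubP (lin_torsion J _) v).2 tv).
(* The relation sending [s * x ^+ (k + l)] to [(s * x ^+ l) *: v] is single-valued because the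
   annihilators of the powers of [x] are stable from [l] on; its extension to [R] gives [e] as the
   image of 1. *)
pose r (a : R^o) (e : submod (torsub J (E i))) :=
  exists s : R, a = s * x ^+ (k + l) /\ e = (s * x ^+ l) *: v1.
have lr : lin_rel r.
  split=> [|a _ _ _ _ [s [-> ->]] [t [-> ->]]].
    by exists 0; rewrite !mul0r scale0r.
  exists (a * s + t); split; first by rewrite mulrDl -mulrA.
  by rewrite mulrDl scalerDl -mulrA scalerA.
have injJ := torsion_injective (J := J) noethR (@ir_injective _ _ E i).
have [|g gE] := injective_extend injJ lr.
  move=> _ [s [/esym s0 ->]]; have: s \in psub (lin0 (k + l)%N).
    by apply/(psubP (lin0 _)); rewrite [_ *: _]mulrC.
  rewrite stabl ?leq_addl // => /psubP xs0.
  by rewrite mulrC [_ * s]xs0 scale0r.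
have gv : x ^+ (k + l) *: val (g (1 : R)) = x ^+ l *: v.
  rewrite -submod_valZ -linearZ (gE _ (x ^+ l *: v1)) //.
  by exists 1; rewrite !mul1r [_ *: 1]mulr1.
exists (w - ir_d E i (val (g (1 : R)))); last by rewrite linearB /= ir_dd subr0.
apply: torsion_adjoin.
  apply: lin_predB (lin_torsion _ _) tw _; apply: torsion_lin.
  exact/(psubP (lin_torsion J _))/(valP (g (1 : R))).
exists (k + l)%N; rewrite scalerBr -linearZ /= gv linearZ /= vE.
by rewrite scalerA -exprD addnC subrr.
Qed.

Definition prime_chain_below c (P : submodule R^o) : Prop :=
  exists C : nat -> prime_idealr R,
    [/\ forall i, (i <= c)%N ->
          forall r : R, (forall x : N, r *: x = 0) -> r \in C i,
        forall i, (i < c)%N -> {subset C i <= C i.+1} /\ ~ {subset C i.+1 <= C i}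
      & forall r : R, (r \in C c) = (r \in P)].

Lemma prime_chain_below0 P : is_prime P -> {subset ann <= P} ->
  prime_chain_below 0 P.
Proof.
move=> hP sannP; exists (fun=> prime_of hP); split=> // i _ r r0.
by rewrite prime_ofE; apply/sannP/annP.
Qed.

Lemma prime_chain_belowS c Q P : is_prime P -> prime_chain_below c Q ->
  {subset Q <= P} -> ~ {subset P <= Q} -> prime_chain_below c.+1 P.
Proof.
move=> hP [C [annC incC CE]] sQP nsPQ.
have annQ (r : R) : (forall x : N, r *: x = 0) -> r \in P.
  by move=> r0; apply: sQP; rewrite -CE; apply: annC.
exists (fun i => if (i <= c)%N then C i else prime_of hP); split=> [i _ r r0|i|r].
- by case: leqP => [ic|_]; [apply: annC | rewrite prime_ofE; apply: annQ].
- rewrite ltnS => ic; rewrite ic; case: ltnP => [|ci]; first exact: incC.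
  have -> : i = c by apply/eqP; rewrite eqn_leq ic.
  split=> [r|h].
    by rewrite CE => /sQP.
  by apply: nsPQ => r rP; rewrite -CE; apply: h.
by rewrite ltnn prime_ofE.
Qed.

(* J is spanned modulo ann by c elements of I, each avoiding those minimal *)
(* primes over the previous ones that do not contain I. *)
Lemma parameter_ideal (I : submodule R^o) c : exists J,
  [/\ torsion_exact J E c,
      forall i (e : E i), torsion I e -> torsion ann e -> torsion J e,
      {subset ann <= J}
    & forall P, is_prime P -> {subset J <= P} ->
        (exists2 x : R, x \in I & x \notin P) -> prime_chain_below c P].
Proof using noethR.
elim: c => [|c [J [exJ torJ sannJ chainJ]]].
  exists ann; split=> // [|P hP sJP _]; first exact: torsion_exact_ann.
  exact: prime_chain_below0.
have [n [Q [hQ coverQ]]] := prime_coverP J noethR.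
pose A := [set i | `[< exists2 x : R, x \in I & x \notin Q i >]].
have [||x xI xA] := @prime_avoidance I n Q A.
- by move=> i; have [] := hQ i.
- by move=> i; rewrite finset.inE => /asboolP.
exists (adjoin J x); split.
- exact: torsion_exact_adjoin.
- move=> i e tI tann; apply: torsion_adjoin; first exact: torJ.
  exact: tI.
- by move=> r /sannJ; apply: adjoin_sub.
move=> P hP sJP [y yI yP].
have [i sQP] := coverQ P hP (fun r rJ => sJP _ (adjoin_sub x rJ)).
have yQ : y \notin Q i by apply: contra yP; apply: sQP.
have iA : i \in A by rewrite finset.inE; apply/asboolP; exists y.
have [hQi sJQ] := hQ i.
apply: (prime_chain_belowS hP) (sQP) _ => [|sPQ].
  by apply: chainJ => //; exists y.
by have /negP[] := xA i iA; apply/sPQ/sJP/adjoin_mem.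
Qed.

Lemma prime_chain_below_dim c P d : prime_chain_below c P -> krull_dim N d ->
  (c <= d)%N.
Proof. by move=> [C [annC incC _]] [_ maxd]; apply: maxd; exists C. Qed.

(* ann_coboundary applies to the inclusion into E i.+1 of the cyclic module *)
(* spanned by z. *)
Lemma ann_torsion_representative I i (z : E i.+1) :
  torsion I z -> ir_d E i.+1 z = 0 ->
  exists2 y : E i, torsion I y & torsion ann (z - ir_d E i y).
Proof using noethR.
move=> tz dz; pose V := submod (imsub (orbit_map z)).
have zV : z \in imsub (orbit_map z).
  by apply/asboolP; exists 1; rewrite /= /orbit_map scale1r.
pose z0 : V := Sub z zV.
have noethV : noetherian V.
  apply: fin_gen_noeth => //; exists 1%N, (fun=> z0) => v.
  have /asboolP[r rE] := valP v; exists (fun=> r).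
  by apply: val_inj; rewrite big_ord1 submod_valZ; apply/esym/rE.
have [|X cofX [g gE]] := @ann_coboundary i.+1 V (fullsub V)
    (val : {linear V -> E i.+1}) noethV.
  move=> v _; have /asboolP[r rE] := valP v.
  have -> : (val : {linear V -> E i.+1}) v = r *: z by apply/esym/rE.
  by rewrite linearZ /= dz scaler0.
exists (g z0).
  move=> x /tz[m xm]; exists m; rewrite -linearZ /=.
  have -> : x ^+ m *: z0 = 0 by apply: val_inj; rewrite submod_valZ.
  by rewrite raddf0.
move=> x /cofX[m xm]; exists m; rewrite scalerBr -!linearZ /=.
rewrite -(gE _ (xm z0 isT)); apply/eqP; rewrite subr_eq0.
exact/eqP/esym/submod_valZ.
Qed.

(* With J spanned by d parameters, z becomes the coboundary of a J-torsion w. *)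
(* For each prime m some multiple s w with s outside m is I-torsion: else a *)
(* prime strictly inside m would end a chain of length d, and m one of d + 1. *)
Lemma grothendieck_vanishing I d : krull_dim N d -> torsion_exact I E d.
Proof using noethR.
move=> dimN i z di tz dz.
have [y ty tann] := ann_torsion_representative tz dz.
pose z' := z - ir_d E i y.
have tz' : torsion I z' by apply: lin_predB (lin_torsion _ _) tz (torsion_lin _ ty).
have dz' : ir_d E i.+1 z' = 0 by rewrite linearB /= dz ir_dd subr0.
suff [w tw wE] : exists2 w, torsion I w & ir_d E i w = z'.
  exists (w + y); first exact: lin_predD (lin_torsion _ _) tw ty.
  by rewrite linearD /= wE subrK.
have [J [exJ torJ sannJ chainJ]] := parameter_ideal I d.
have [w tw wE] := exJ i z' di (torJ _ _ tz' tann) dz'.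
(* These are the scalars [r] for which [r *: z'] is the coboundary of an [I]-torsion element; were 1
   not among them, they would lie in a prime [m]. *)
have linA : @lin_pred R^o
    (fun r => exists2 w, torsion I w & ir_d E i w = (r : R) *: z').
  split=> [|a r s [u tu uE] [v tv vE]].
    by exists 0; [exact: (lin_torsion _ _).1 | rewrite raddf0 scale0r].
  exists (a *: u + v); first exact: (lin_torsion _ _).2.
  by rewrite linearP uE vE scalerDl -scalerA.
suff /(psubP linA)[u tu uE] : (1 : R) \in psub linA.
  by exists u; rewrite // uE scale1r.
apply: contrapT => /negP A1.
have [|a b -> ->|a ->|m [hm sAm _]] :=
  @prime_disjoint (psub linA) (fun a => a = 1) noethR; rewrite ?mulr1 //.
have mem_m (r : R) (u : E i) : torsion I u -> ir_d E i u = r *: z' -> r \in m.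
  by move=> tu uE; apply/sAm/(psubP linA); exists u.
have sIm : {subset I <= m}.
  move=> x xI; have [k xk] := tz' x xI; apply: (@prime_exp m x k hm).
  apply: (@mem_m _ 0); first exact: (lin_torsion _ _).1.
  by rewrite raddf0 xk.
have local (x : R) : x \in I ->
    exists s : R, s \notin m /\ exists k, (s * x ^+ k) *: w = 0.
  move=> xI; apply: contrapT => nolocal.
  (* A prime [P] missing [T] and containing the annihilator of [w] contains [J], lies in [m] and
     misses [x], which is in [m]; so [m] would end a chain of length [d + 1]. *)
  pose T (t : R) := exists s : R, s \notin m /\ exists k, t = s * x ^+ k.
  have [|a b [s [sm [k ->]]] [s' [s'm [k' ->]]]|a [s [sm [k ->]]]|P [hP annP TP]] :=
    @prime_disjoint (kersub (orbit_map w)) T noethR.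
  - by exists 1; split; [exact: hm.1 | exists 0%N; rewrite mulr1].
  - exists (s * s'); split; last by exists (k + k')%N; rewrite mulrACA -exprD.
    by apply/negP => /hm.2[]; apply/negP.
  - by apply/negP => /eqP w0; apply: nolocal; exists s; split=> //; exists k.
  have sJP : {subset J <= P}.
    move=> r /tw[k rk]; apply: (@prime_exp P r k hP); apply: annP; exact/eqP.
  have xP : x \notin P.
    by apply: TP; exists 1; split; [exact: hm.1 | exists 1%N; rewrite mul1r].
  have chainP := chainJ P hP sJP (ex_intro2 _ _ x xI xP).
  have: (d.+1 <= d)%N.
    apply: prime_chain_below_dim dimN; apply: (prime_chain_belowS hm chainP).
      move=> r rP; apply: contrapT => /negP rm.
      have Tr : T r by exists r; split=> //; exists 0%N; rewrite mulr1.
      by have /negP[] := TP r Tr.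
    by move=> smP; case/negP: xP; apply/smP/sIm.
  by rewrite ltnn.
(* The annihilators of the [s *: w] with [s] outside [m] are directed. The greatest one gives a
   single [s] with [s *: w] [I]-torsion, which forces [s] into [m]. *)
pose Q (T : submodule R^o) := exists s : R, s \notin m /\
  forall r : R, r \in T <-> (r * s) *: w = 0.
have linQ (s : R) : @lin_pred R^o (fun r => ((r : R) * s) *: w = 0).
  split=> [|a r r' r0 r'0]; first by rewrite mul0r scale0r.
  by rewrite mulrDl -mulrA scalerDl -scalerA r0 r'0 scaler0 addr0.
have [||T [s [sm TE]] maxT] := noeth_directed (P := Q) noethR.
- exists (psub (linQ 1)), 1; split=> [|r]; first exact: hm.1.
  exact: (psubP (linQ 1)).
- move=> T T' [s [sm TE]] [s' [s'm T'E]]; exists (psub (linQ (s * s'))); split.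
  + exists (s * s'); split=> [|r]; last exact: (psubP (linQ (s * s'))).
    by apply/negP => /hm.2[]; apply/negP.
  + move=> r /TE r0; apply/(psubP (linQ _)).
    by rewrite mulrA mulrC -scalerA r0 scaler0.
  + move=> r /T'E r0; apply/(psubP (linQ _)).
    by rewrite mulrCA -scalerA r0 scaler0.
case/negP: sm; apply: (@mem_m s (s *: w)); last by rewrite linearZ /= wE.
move=> x /local[s' [s'm [k xk]]]; exists k; rewrite scalerA; apply/TE.
apply: (maxT (psub (linQ s'))); last by apply/(psubP (linQ s')); rewrite mulrC.
by exists s'; split=> // r; exact: (psubP (linQ s')).
Qed.

(** * Dimension zero *)

Lemma artinian_between_total V (X : submodule V) :
  artinian_between (zerosub V) X -> (forall x, x \in X) -> artinian V.
Proof.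
move=> artX X1; apply: artinian_between_full => S decS _ sBS.
apply: artX => // n x _.
exact: X1.
Qed.

(** Let [X] be a maximal artinian submodule. If [X] is proper, a maximal ideal [T] among the [X : y]
    with [y] outside [X] is prime; dimension 0 makes it a maximal ideal of [R], so [(X + R y) / X],
    a copy of [R / T], is artinian and [X] can be enlarged. *)
Lemma krull_dim0_artinian : fin_gen N -> krull_dim N 0 -> artinian N.
Proof using noethR.
move=> fgN dimN; have noethN := fin_gen_noeth noethR fgN.
have [|X artX maxX] := noeth_max (P := artinian_between (zerosub N)) noethN.
  exists (zerosub N) => S _ sS0 s0S; exists 0%N => n _ x.
  by apply/idP/idP => /sS0/s0S.
apply: (artinian_between_total artX) => x; apply: contrapT => /negP xX.
have linC y : @lin_pred R^o (fun r => (r : R) *: y \in X).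
  split=> [|a r s rX sX]; first by rewrite scale0r; apply: (rpred0 X).
  by rewrite scalerDl -scalerA; apply: (sub_lin X).2.
pose P (T : submodule R^o) := exists y, y \notin X /\
  forall r : R, r \in T <-> r *: y \in X.
have [|T [y [yX TE]] maxT] := noeth_max (P := P) noethR.
  by exists (psub (linC x)), x; split=> // r; exact: (psubP (linC x)).
have hT : is_prime T.
  split=> [|a b abT]; first by apply/negP => /TE; rewrite scale1r; apply/negP.
  have [/TE bX|bX] := boolP (b \in T); first by right.
  have byX : b *: y \notin X by apply: contra bX => /TE.
  left; apply: (maxT (psub (linC (b *: y)))).
  - by exists (b *: y); split=> // r; exact: (psubP (linC (b *: y))).
  - move=> r /TE rX; apply/(psubP (linC _)).
    by rewrite scalerA mulrC -scalerA; apply: rpredZ.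
  by apply/(psubP (linC _)); rewrite scalerA; apply/TE.
have sannT : {subset ann <= T}.
  by move=> r /annP r0; apply/TE; rewrite r0; apply: (rpred0 X).
have maxIdT (S : submodule R^o) (r : R) :
    {subset T <= S} -> r \in S -> r \notin T ->
    (1 : R) \in S.
  move=> sTS rS rT; apply: contrapT => /negP S1.
  have [|a b -> ->|a ->|m [hm sSm _]] :=
    @prime_disjoint S (fun a => a = 1) noethR; rewrite ?mulr1 //.
  have chainT := prime_chain_below0 hT sannT.
  suff /prime_chain_below_dim/(_ dimN) : prime_chain_below 1 m by [].
  apply: (prime_chain_belowS hm chainT) => [t /sTS/sSm //|smT].
  by case/negP: rT; apply/smT/sSm.
have linXy := lin_sum (sub_lin X) (lin_line y).
have sXXy : {subset X <= psub linXy}.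
  by move=> v vX; apply/psubP; exists v => //; exists 0; rewrite subrr scale0r.
case/negP: yX; apply: (maxX (psub linXy)) => //; last first.
  by apply/psubP; exists 0; [exact: rpred0 | exists 1; rewrite subr0 scale1r].
apply: (artinian_between_trans (X := X)) => // [v /eqP -> |]; first exact: rpred0.
have artRT : artinian_between T (fullsub R^o).
  move=> S decS _ sTS.
  have [[n Sn1]|S1] := pselect (exists n, (1 : R) \notin S n).
    have sST k : (n <= k)%N -> {subset S k <= T}.
      move=> nk r /(antimono decS nk) rS; apply: contrapT => /negP rT.
      by case/negP: Sn1; apply: maxIdT rS rT.
    exists n => k nk r.
    by apply/idP/idP => [/(sST k nk)|/(sST n (leqnn n))]; apply: sTS.
  have full n (r : R) : r \in S n.
    rewrite -[r]mulr1; apply: ideal_mull; apply: contrapT => /negP Sn1.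
    by apply: S1; exists n.
  by exists 0%N => k _ r; rewrite !full.
apply: (artinian_between_transfer
  (r := fun v (c : R^o) => v - (c : R) *: y \in X) _ _ artRT) => //.
- split=> [|a v c v' c' vX v'X]; first by rewrite scale0r subr0; apply: (rpred0 X).
  rewrite scalerDl opprD addrACA -scalerA -scalerBr.
  exact: (sub_lin X).2.
- move=> v /psubP[u uX [c cE]]; exists c => //; by rewrite -cE subKr.
move=> v c _ /TE cyX vX; rewrite -(subrK (c *: y) v); exact: rpredD.
Qed.

End Vanishing.

End IdealTransformArtinian.

Theorem theorem2p12 (R : comNzRingType) (I : submodule R^o) (M : lmodType R) :
  noetherian_ring R -> fin_gen M ->
  (forall N : lmodType R, artinian N ->
     forall (E : injective_resolution N) (i : nat),
       artinian (right_derived (ideal_transform I M) E i)) /\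
  (forall (N : lmodType R) (p d : nat),
     fin_gen N -> proj_dim M p -> krull_dim N d ->
     forall E : injective_resolution N,
       artinian (right_derived (ideal_transform I M) E (p + d))).
Proof.
move=> noethR fgM; split=> [N artN E i|N p d fgN [pdM _] dimN E].
  exact: transform_artinian.
(* For [d = 0] the group [Ext^p(M, N)] need not vanish, so this case goes through part (i). *)
case: d dimN => [|d] dimN.
  by apply: transform_artinian => //; apply: krull_dim0_artinian.
by apply: right_derived_pd => //; apply: grothendieck_vanishing.
Qed.
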